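(* Let $\tau=\sqrt{\frac{1+\sqrt5}{2}}$ and $\sigma=\sqrt{\frac{-1+\sqrt5}{2}}$, and let $\lambda_0$ be the largest real positive root $\lambda$ of the equation $$\begin{aligned}-8=\;&\left(3+i+\sqrt5\,(\tau+\sigma i)\right)e^{(\sigma+\tau i)/\lambda}+\left(3-i+\sqrt5\,(\tau-\sigma i)\right)e^{(\sigma-\tau i)/\lambda}\\&+\left(3-i+\sqrt5\,(-\tau+\sigma i)\right)e^{(-\sigma+\tau i)/\lambda}+\left(3+i+\sqrt5\,(-\tau-\sigma i)\right)e^{(-\sigma-\tau i)/\lambda}.\end{aligned}$$ Then $\lambda_0$ is the largest eigenvalue (in modulus) of the operator $T$ on $L^2([0,1]^3)$ associated with avoiding triple ascents and triple descents, and the number $\alpha_n$ of permutations in the symmetric group $\mathfrak{S}_n$ without triple ascents and triple descents satisfies $$\alpha_n/n!=c\cdot\lambda_0^{\,n-3}+O(r^n),$$ where $c$ and $r$ are two positive constants such that $r<\lambda_0$.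
   Context: A permutation $\pi=\pi_1\cdots\pi_n$ has a triple ascent if $\pi_i<\pi_{i+1}<\pi_{i+2}<\pi_{i+3}$ for some $i$, and a triple descent if $\pi_i>\pi_{i+1}>\pi_{i+2}>\pi_{i+3}$ for some $i$ (so $\alpha_n$ counts permutations consecutively avoiding $1234$ and $4321$). The associated operator $T$ on the complex Hilbert space $L^2([0,1]^3)$ is $$T(f)(x_1,x_2,x_3)=\int_0^1\chi(t,x_1,x_2,x_3)\,f(t,x_1,x_2)\,dt,$$ where, for points of $[0,1]^4$ with distinct coordinates, $\chi(y_1,y_2,y_3,y_4)=0$ if $y_1<y_2<y_3<y_4$ or $y_1>y_2>y_3>y_4$, and $\chi(y_1,y_2,y_3,y_4)=1$ otherwise (points with equal coordinates form a null set and are ignored). The asymptotic statement is as $n\to\infty$. *)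

(* Defs.v *)
From HB Require Import structures.
From mathcomp Require Import all_boot all_order all_fingroup all_algebra.
From mathcomp Require Import all_classical all_reals all_analysis.
From mathcomp Require Import complex.

Set Implicit Arguments.
Unset Strict Implicit.
Unset Printing Implicit Defensive.

Import Order.TTheory GRing.Theory Num.Theory.
Import numFieldNormedType.Exports.

Local Open Scope classical_set_scope.
Local Open Scope ring_scope.
Local Open Scope complex_scope.

Definition triple_ascent (n : nat) (s : 'S_n) : Prop :=
  exists i1 i2 i3 i4 : 'I_n,
    [/\ i2 = i1.+1 :> nat, i3 = i1.+2 :> nat & i4 = i1.+3 :> nat] /\
    [/\ (s i1 < s i2)%N, (s i2 < s i3)%N & (s i3 < s i4)%N].

Definition triple_descent (n : nat) (s : 'S_n) : Prop :=
  exists i1 i2 i3 i4 : 'I_n,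
    [/\ i2 = i1.+1 :> nat, i3 = i1.+2 :> nat & i4 = i1.+3 :> nat] /\
    [/\ (s i1 > s i2)%N, (s i2 > s i3)%N & (s i3 > s i4)%N].

Definition alpha (n : nat) : nat :=
  #|[set s : 'S_n | `[< ~ triple_ascent s /\ ~ triple_descent s >]]%SET|.

Section Operator.
Context {R : realType}.

Definition chi (y1 y2 y3 y4 : R) : R :=
  if [&& y1 < y2, y2 < y3 & y3 < y4] || [&& y1 > y2, y2 > y3 & y3 > y4]
  then 0 else 1.

(* measurableTypeR R is R with the sigma-algebra on which lebesgue_measure is
   defined. *)
Local Notation R3 :=
  (measurableTypeR R * measurableTypeR R * measurableTypeR R)%type.

Definition cube : set R3 := `[0, 1] `*` `[0, 1] `*` `[0, 1].

Definition leb3 : {measure set R3 -> \bar R} :=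
  ((@lebesgue_measure R \x @lebesgue_measure R) \x @lebesgue_measure R)%E.

(* If the real or imaginary part is not integrable, the value is meaningless;
   for f in L^2(cube), Fubini ensures that this only happens in opT on a null
   set of points. *)
Definition cintegral (D : set R) (g : R -> R[i]) : R[i] :=
  (\int[lebesgue_measure]_(t in D) complex.Re (g t)) +i*
  (\int[lebesgue_measure]_(t in D) complex.Im (g t)).

(* Elements of the Hilbert space L^2([0,1]^3) are represented by functions,
   equality of which is almost everywhere equality on the cube; the values
   outside the cube are irrelevant. *)
Definition L2_cube (f : R3 -> R[i]) : Prop :=
  [/\ measurable_fun cube (fun x => complex.Re (f x)),
      measurable_fun cube (fun x => complex.Im (f x)) &
      (\int[leb3]_(x in cube) (complex.Re (`|f x| ^+ 2))%:E < +oo)%E].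

Definition ae_eq_cube (f g : R3 -> R[i]) : Prop :=
  {ae leb3, forall x, cube x -> f x = g x}.

Definition opT (f : R3 -> R[i]) : R3 -> R[i] :=
  fun x => let: (x1, x2, x3) := x in
    cintegral `[0, 1] (fun t => (chi t x1 x2 x3)%:C * f (t, x1, x2)).

Definition is_eigenvalue (mu : R[i]) : Prop :=
  exists f : R3 -> R[i],
    [/\ L2_cube f, ~ ae_eq_cube f (fun=> 0) &
        ae_eq_cube (opT f) (fun x => mu * f x)].

(* The largest eigenvalue in modulus is unique: every other eigenvalue has
   strictly smaller modulus. *)
Definition is_largest_eigenvalue (mu : R[i]) : Prop :=
  is_eigenvalue mu /\
  (forall nu : R[i], is_eigenvalue nu -> nu != mu -> `|nu| < `|mu|).

Definition cexp (z : R[i]) : R[i] :=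
  (expR (complex.Re z))%:C * (cos (complex.Im z) +i* sin (complex.Im z)).

Definition tau : R := Num.sqrt ((1 + Num.sqrt 5) / 2).
Definition sigma : R := Num.sqrt ((- 1 + Num.sqrt 5) / 2).

Definition eigen_equation (lambda : R) : Prop :=
  let i : R[i] := 'i in
  let s5 : R[i] := (Num.sqrt 5)%:C in
  let t : R[i] := tau%:C in
  let s : R[i] := sigma%:C in
  let l : R[i] := lambda%:C in
  - 8%:R =
    (3%:R + i + s5 * (t + s * i)) * cexp ((s + t * i) / l)
    + (3%:R - i + s5 * (t - s * i)) * cexp ((s - t * i) / l)
    + (3%:R - i + s5 * (- t + s * i)) * cexp ((- s + t * i) / l)
    + (3%:R + i + s5 * (- t - s * i)) * cexp ((- s - t * i) / l).

Definition is_largest_positive_root (lambda : R) : Prop :=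
  [/\ 0 < lambda, eigen_equation lambda &
      forall l : R, 0 < l -> eigen_equation l -> l <= lambda].

End Operator.

(* Main.v *)
(* Write U for the operator T on the functions of (x1, x2, x3) that depend only
   on x1 and on the two signs of x2 - x1 and x3 - x2.  It acts on quadruples of
   functions of one variable through the primitives from 0 and to 1, and, by
   counting permutations according to their last value, alpha_n / n! is a sum of
   two values of U^n 1.

   The eigenvalue equation of U reduces to linear differential equations whose
   solutions combine cosh, sinh (sigma z x) and cos, sin (tau z x) with
   z = 1 / lambda; the equation of the theorem, divided by 4, factors into two
   real functions of z, one of which is positive up to the first zero of the
   other.  At that zero there is an explicit nonnegative eigenfunction phi.

   A fourth power of U maps every nonnegative y above a positive multiple of phi,
   with a factor that is a linear functional of y.  Hence lambda0^-n U^n y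
   converges geometrically to a multiple of phi; this gives the asymptotics.

   The adjoint of T is T conjugated by the reversal of the coordinates, and T^2
   maps bounded functions to functions of the above kind, because chi only
   depends on the signs of the differences.  If T f = nu f, then the pairing of
   f with the reversal of T^(n+2) G is nu^(n+2) times that of f with the reversal
   of G, and also a multiple of lambda0^n up to an error O((rho lambda0)^n) with
   rho < 1.  When |nu| >= lambda0 and nu <> lambda0 this forces all these
   pairings to vanish, hence f = 0. *)

From HB Require Import structures.
Require Import Defs.
From mathcomp Require Import all_boot all_order all_fingroup all_algebra.
From mathcomp Require Import all_classical all_reals all_analysis.
From mathcomp Require Import complex.
From mathcomp Require Import measurable_realfun zify ring lra.

Import Order.TTheory GRing.Theory Num.Theory.
Import numFieldNormedType.Exports.

Local Open Scope classical_set_scope.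
Local Open Scope ring_scope.

Set Implicit Arguments.
Unset Strict Implicit.
Unset Printing Implicit Defensive.

(** * Primitives on the unit interval *)

Section Primitive.
Context {R : realType}.
Implicit Types (g h G : R -> R) (x y c : R).
Notation mu := (@lebesgue_measure R).

(** Since [T] is not self-adjoint, the gap below lambda0 is obtained from order alone, by a
    Doeblin-type minorisation: four applications give back a fixed share of the excess of y over m
    phi, measured by the functional [theta], and the same functional governs the excess of M phi
    over y. Bounds are stated against phi and not against constants, because phi vanishes at one end
    point for the types of two equal signs; the explicit family [prof], with the same zeros,
    mediates between phi and sup-norm bounds.

    This convergence concerns bounded functions, while an eigenfunction of [T] is only square
    integrable. Moving the iterates to a bounded test function through the adjoint avoids any
    regularity theory for eigenfunctions. Complex eigenvalues are handled through pairs of real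
    functions.

    Complementation, x -> 1 - x with both signs reversed, commutes with U. It splits eigenfunctions
    into invariant and anti-invariant ones, which explains the two factors of the equation; the
    positive eigenfunction is sought among the invariant ones. *)

Definition bmeas g : Prop :=
  measurable_fun (`[0, 1] : set R) g /\ exists M : R, forall x, 0 <= x <= 1 -> `|g x| <= M.

Definition lint g x : R := \int[mu]_(t in `[0, x]) g t.
Definition rint g x : R := lint g 1 - lint g x.

Lemma bmeas_integrable g : bmeas g -> mu.-integrable `[0, 1] (EFin \o g).
Proof.
case=> mg [M gM]; apply: measurable_bounded_integrable => //=.
  by rewrite lebesgue_measure_itv/= lte_fin ltr01 oppr0 adde0 ltry.
exists M; split; first exact: num_real.
move=> N MN x /=; rewrite in_itv/= => x01.
exact: le_trans (gM _ x01) (ltW MN).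
Qed.

Lemma bmeas_integrable_sub g x y : 0 <= x -> y <= 1 -> bmeas g ->
  mu.-integrable `[x, y] (EFin \o g).
Proof.
move=> x0 y1 /bmeas_integrable; apply: integrableS => //.
by apply: subset_itv; rewrite bnd_simp.
Qed.

Lemma bmeas_lin g h c d : bmeas g -> bmeas h ->
  bmeas (fun x => c * g x + d * h x).
Proof.
move=> [mg [M gM]] [mh [N hN]]; split.
  by apply: measurable_funD; apply: measurable_funM => //;
    exact: measurable_cst.
exists (`|c| * M + `|d| * N) => x x01; apply: le_trans (ler_normD _ _) _.
by rewrite !normrM lerD// ler_wpM2l ?normr_ge0 ?gM ?hN.
Qed.

Lemma bmeas_cst c : bmeas (fun=> c).
Proof. by split; [exact: measurable_cst|exists `|c|]. Qed.

Lemma continuous_bmeas g : continuous g -> bmeas g.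
Proof.
move=> cg; split.
  exact: measurable_funTS (continuous_measurable_fun cg).
have cg1 : {within `[0, 1], continuous g}.
  exact: continuous_subspaceT.
have := compact_bounded (continuous_compact cg1 (@segment_compact R 0 1)).
move=> [M [_ HM]]; exists (M + 1) => x x01; apply: (HM (M + 1)).
  by rewrite ltrDl.
by exists x => //=; rewrite in_itv.
Qed.

Lemma lint0 g : lint g 0 = 0.
Proof. by rewrite /lint set_itv1 Rintegral_set1. Qed.

Lemma eq_lint g h x : x <= 1 -> (forall t, 0 <= t <= 1 -> g t = h t) ->
  lint g x = lint h x.
Proof.
move=> x1 gh; apply: eq_Rintegral => t; rewrite inE/= in_itv/= => /andP[t0 tx].
by rewrite gh// t0 (le_trans tx).
Qed.

Lemma lint_lin g h c d x : 0 <= x <= 1 -> bmeas g -> bmeas h ->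
  lint (fun t => c * g t + d * h t) x = c * lint g x + d * lint h x.
Proof.
move=> /andP[x0 x1] bg bh.
have ig := bmeas_integrable_sub (lexx 0) x1 bg.
have ih := bmeas_integrable_sub (lexx 0) x1 bh.
rewrite /lint RintegralD//; last 2 first.
- have := integrableZl _ c ig => /(_ _)/= H.
  by under [X in integrable _ _ X]eq_fun do rewrite /= EFinM; apply: H.
- have := integrableZl _ d ih => /(_ _)/= H.
  by under [X in integrable _ _ X]eq_fun do rewrite /= EFinM; apply: H.
by rewrite !RintegralZl.
Qed.

Lemma rint_lin g h c d x : 0 <= x <= 1 -> bmeas g -> bmeas h ->
  rint (fun t => c * g t + d * h t) x = c * rint g x + d * rint h x.
Proof.
move=> x01 bg bh; rewrite /rint !lint_lin// ?ler01 ?lexx//.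
by rewrite !mulrBr opprD addrACA.
Qed.

Lemma lintB g x y : 0 <= x -> x <= y -> y <= 1 -> bmeas g ->
  lint g y - lint g x = \int[mu]_(t in `]x, y]) g t.
Proof.
move=> x0 xy y1 bg; rewrite /lint Rintegral_itvB ?bnd_simp//.
exact: bmeas_integrable_sub.
Qed.

Lemma ler_lintB g h x y : 0 <= x -> x <= y -> y <= 1 -> bmeas g -> bmeas h ->
  (forall t, x <= t <= y -> g t <= h t) ->
  lint g y - lint g x <= lint h y - lint h x.
Proof.
move=> x0 xy y1 bg bh gh; rewrite !lintB//.
have sub : `]x, y] `<=` `[0, 1].
  by apply: subset_itv; rewrite bnd_simp.
apply: le_Rintegral => //.
- by apply: integrableS (bmeas_integrable bg).
- by apply: integrableS (bmeas_integrable bh).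
- by move=> t /=; rewrite in_itv/= => /andP[/ltW xt ty]; rewrite gh// xt.
Qed.

Lemma lint_cst c x : 0 <= x -> lint (fun=> c) x = c * x.
Proof.
move=> x0; rewrite /lint Rintegral_cst//= lebesgue_measure_itv/= lte_fin.
case: ltgtP x0 => //= [x0 _|<- _]; last by rewrite mulr0.
by rewrite oppr0 addr0.
Qed.

Lemma ler_lint g h x : 0 <= x <= 1 -> bmeas g -> bmeas h ->
  (forall t, 0 <= t <= x -> g t <= h t) -> lint g x <= lint h x.
Proof.
move=> /andP[x0 x1] bg bh gh.
by have := ler_lintB (lexx 0) x0 x1 bg bh gh; rewrite !lint0 !subr0.
Qed.

Lemma ler_rint g h x : 0 <= x <= 1 -> bmeas g -> bmeas h ->
  (forall t, x <= t <= 1 -> g t <= h t) -> rint g x <= rint h x.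
Proof. by move=> /andP[x0 x1] *; apply: ler_lintB. Qed.

Lemma bmeas_lint g : bmeas g -> bmeas (lint g).
Proof.
move=> bg.
have cg := parameterized_integral_continuous ler01 (bmeas_integrable bg).
split; first by apply: subspace_continuous_measurable_fun.
have := compact_bounded (continuous_compact cg (@segment_compact R 0 1)).
move=> [M [_ HM]]; exists (M + 1) => x x01; apply: (HM (M + 1)).
  by rewrite ltrDl.
by exists x => //=; rewrite in_itv.
Qed.

Lemma bmeas_rint g : bmeas g -> bmeas (rint g).
Proof.
move=> bg.
have := bmeas_lin (lint g 1) (-1) (bmeas_cst 1) (bmeas_lint bg).
congr (bmeas _); apply/funext => x.
by rewrite mulr1 mulN1r.
Qed.

Lemma is_derive_continuous (g G : R -> R) :
  (forall t : R, is_derive t (1 : R) G (g t)) -> continuous G.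
Proof.
by move=> dG t; apply/differentiable_continuous/derivable1_diffP; case: (dG t).
Qed.

Lemma lint_derive g G x : 0 <= x -> continuous g ->
  (forall t, is_derive t (1 : R) G (g t)) -> lint g x = G x - G 0.
Proof.
rewrite le_eqVlt => /predU1P[<-|x0] cg dG; first by rewrite lint0 subrr.
have cG := is_derive_continuous dG.
rewrite /lint /Rintegral (continuous_FTC2 (F := G) x0)//.
- exact: continuous_subspaceT.
- split.
  + by move=> t _; case: (dG t).
  + by apply: cvg_at_right_filter; exact: cG.
  + by apply: cvg_at_left_filter; exact: cG.
- by move=> t _; rewrite derive1E derive_val.
Qed.

Lemma is_derive_add (f h : R -> R) (x a b : R) :
  is_derive x (1 : R) f a -> is_derive x (1 : R) h b ->
  is_derive x (1 : R) (fun t => f t + h t) (a + b).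
Proof. exact: is_deriveD. Qed.

Lemma is_derive_mulc (f : R -> R) (c x a : R) :
  is_derive x (1 : R) f a -> is_derive x (1 : R) (fun t => c * f t) (c * a).
Proof. exact: is_deriveZ. Qed.

Lemma is_derive_affine (f : R -> R) (c d x a : R) :
  is_derive (c * x + d) (1 : R) f a ->
  is_derive x (1 : R) (fun t => f (c * t + d)) (c * a).
Proof.
move=> df; rewrite mulrC.
apply: (@is_derive1_comp _ f (fun t => c * t + d) x _ c df).
rewrite -[X in is_derive _ _ _ X]addr0 -[in X in is_derive _ _ _ X](mulr1 c).
exact: is_derive_add.
Qed.

Lemma is_derive_expn (f : R -> R) (n : nat) (x a : R) :
  is_derive x (1 : R) f a ->
  is_derive x (1 : R) (fun t => f t ^+ n) (n%:R * f x ^+ n.-1 * a).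
Proof.
move=> df; rewrite (_ : (fun t => f t ^+ n) = f ^+ n); first exact: is_deriveX.
apply/funext => t; elim: n => [|n IH]; first by rewrite !expr0.
by rewrite !exprS IH.
Qed.

End Primitive.

(** * The operator on families of functions of one variable *)

Opaque lint.

Section Transfer.
Context {R : realType}.
Local Notation fam := (bool -> bool -> R -> R).
Implicit Types (y z : fam) (x c d m M : R).

Definition bfam y := forall p q, bmeas (y p q).
Definition lefam y z := forall p q x, 0 <= x <= 1 -> y p q x <= z p q x.

Definition lcomb c y d z : fam := fun p q x => c * y p q x + d * z p q x.

(* A family [y] encodes the function [y (x1 < x2) (x2 < x3) x1] of three
   variables; [Kop] is the operator of the theorem on such functions. *)
Definition Kop y : fam := fun p q x =>
  (if p && q then 0 else lint (y true p) x) +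
  (if ~~ p && ~~ q then 0 else rint (y false p) x).

Lemma bfam_lcomb c y d z : bfam y -> bfam z -> bfam (lcomb c y d z).
Proof. by move=> by_ bz p q; apply: bmeas_lin. Qed.

Lemma bfam_Kop y : bfam y -> bfam (Kop y).
Proof.
move=> by_ p q; rewrite /Kop.
have H1 : bmeas (fun x => if p && q then 0 else lint (y true p) x).
  by case: (p && q); [exact: bmeas_cst|exact: bmeas_lint].
have H2 : bmeas (fun x => if ~~ p && ~~ q then 0 else rint (y false p) x).
  by case: (~~ p && _); [exact: bmeas_cst|exact: bmeas_rint].
have := bmeas_lin 1 1 H1 H2; congr bmeas; apply/funext => x.
by rewrite !mul1r.
Qed.

Lemma bfam_iterKop n y : bfam y -> bfam (iter n Kop y).
Proof. by move=> ?; elim: n => //= n ?; apply: bfam_Kop. Qed.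

Lemma lefam_Kop y z : bfam y -> bfam z -> lefam y z -> lefam (Kop y) (Kop z).
Proof.
move=> by_ bz yz p q x x01; rewrite /Kop; have /andP[x0 x1] := x01.
apply: lerD; case: ifP => // _.
  apply: ler_lint => // t /andP[t0 tx]; apply: yz.
  by rewrite t0 (le_trans tx).
apply: ler_rint => // t /andP[xt t1]; apply: yz.
by rewrite t1 (le_trans x0).
Qed.

Lemma lefam_iterKop n y z : bfam y -> bfam z -> lefam y z ->
  lefam (iter n Kop y) (iter n Kop z).
Proof.
by move=> by_ bz yz; elim: n => //= n IH; apply: lefam_Kop => //;
  apply: bfam_iterKop.
Qed.

Lemma Kop_lcomb c y d z p q x : bfam y -> bfam z -> 0 <= x <= 1 ->
  Kop (lcomb c y d z) p q x = c * Kop y p q x + d * Kop z p q x.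
Proof.
move=> by_ bz x01; rewrite /Kop /lcomb lint_lin// rint_lin//.
by case: ifP => _; case: ifP => _; ring.
Qed.

Lemma eq_Kop y z p q x : (forall p q x, 0 <= x <= 1 -> y p q x = z p q x) ->
  0 <= x <= 1 -> Kop y p q x = Kop z p q x.
Proof.
move=> yz /andP[x0 x1]; rewrite /Kop /rint.
rewrite (eq_lint x1 (yz true p)) (eq_lint x1 (yz false p)).
by rewrite (eq_lint (lexx _) (yz false p)).
Qed.

Lemma iterKop_lcomb n c y d z p q x : bfam y -> bfam z -> 0 <= x <= 1 ->
  iter n Kop (lcomb c y d z) p q x = c * iter n Kop y p q x + d * iter n Kop z p q x.
Proof.
move=> by_ bz; elim: n p q x => [//|n IH] p q x x01 /=.
rewrite (eq_Kop (z := lcomb c (iter n Kop y) d (iter n Kop z)))//.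
by rewrite Kop_lcomb//; apply: bfam_iterKop.
Qed.

Definition zfam : fam := fun _ _ _ => 0.

Lemma bfam0 : bfam zfam. Proof. by move=> ? ?; apply: bmeas_cst. Qed.

Lemma Kop_ge0 y : bfam y -> lefam zfam y -> lefam zfam (Kop y).
Proof.
move=> by_ y0 p q x x01.
have := lefam_Kop bfam0 by_ y0 p q x01; apply: le_trans.
by rewrite /Kop /zfam /rint !lint_cst ?ler01 ?(andP x01).1 // !mul0r subrr !if_same addr0.
Qed.

(** For two ascents [Kop] keeps only a primitive that vanishes at 1, for two descents only one that
    vanishes at 0. Images of positive families have no other forced zeros, hence this shape. *)
Definition prof : fam := fun p q x =>
  if p && q then 1 - x else if ~~ p && ~~ q then x else 1.

(** This is the integral of (1 - x) y true false x, in the form in which two successive primitives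
    produce it. *)
Definition theta y : R := lint (lint (y true false)) 1.

Lemma ler_theta y z : bfam y -> bfam z -> lefam y z -> theta y <= theta z.
Proof.
move=> by_ bz yz; apply: ler_lint; rewrite ?ler01 ?lexx//; try exact: bmeas_lint.
move=> t /andP[t0 t1]; apply: ler_lint => //; first by rewrite t0.
by move=> s /andP[s0 st]; apply: yz; rewrite s0 (le_trans st).
Qed.

Lemma theta0 : theta zfam = 0.
Proof.
rewrite /theta (eq_lint (h := fun=> 0))// => [|t /andP[t0 _]].
  by rewrite lint_cst ?ler01// mul0r.
by rewrite lint_cst// mul0r.
Qed.

Lemma theta_lcomb c y d z : bfam y -> bfam z ->
  theta (lcomb c y d z) = c * theta y + d * theta z.
Proof.
move=> by_ bz; rewrite /theta /lcomb -lint_lin ?ler01 ?lexx//;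
  try exact: bmeas_lint.
by apply: eq_lint => // t t01; rewrite lint_lin.
Qed.

Lemma is_derive_onem_exp (k : nat) (t : R) :
  is_derive t (1 : R) (fun u : R => (1 - u) ^+ k) (- k%:R * (1 - t) ^+ k.-1).
Proof.
have -> : - k%:R * (1 - t) ^+ k.-1 = -1 * (k%:R * (-1 * t + 1) ^+ k.-1 * 1).
  by rewrite mulr1 mulN1r -mulNr mulN1r [- t + _]addrC.
have -> : (fun u : R => (1 - u) ^+ k) = (fun u : R => (-1 * u + 1) ^+ k).
  by apply/funext => u; rewrite mulN1r [- u + _]addrC.
apply: (@is_derive_affine _ (fun u => u ^+ k)).
exact: (is_derive_expn k (is_derive_id _ (1 : R))).
Qed.

Lemma continuous_onem_exp (k : nat) : continuous (fun u : R => (1 - u) ^+ k).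
Proof. exact: is_derive_continuous (is_derive_onem_exp k). Qed.

Lemma lint_monom (k : nat) x : 0 <= x ->
  lint (fun t => (1 - t) ^+ k) x = (1 - (1 - x) ^+ k.+1) / k.+1%:R.
Proof.
move=> x0; have nz : k.+1%:R != 0 :> R by rewrite pnatr_eq0.
have dG (t : R) : is_derive t (1 : R) (fun u => - k.+1%:R^-1 * (1 - u) ^+ k.+1)
    ((1 - t) ^+ k).
  have -> : (1 - t) ^+ k = - k.+1%:R^-1 * (- k.+1%:R * (1 - t) ^+ k).
    by rewrite mulrA mulrNN mulVf// mul1r.
  apply: is_derive_mulc; exact: is_derive_onem_exp.
rewrite (lint_derive x0 (@continuous_onem_exp k) dG).
by rewrite subr0 expr1n; ring.
Qed.

(** The function [lint f] is nondecreasing, so its mean over [x, 1] is at least its mean over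
    [0, 1]. *)
Lemma theta_le_rint (f : R -> R) x : bmeas f -> 0 <= x <= 1 ->
  (forall t, 0 <= t <= 1 -> 0 <= f t) ->
  lint (lint f) 1 * (1 - x) <= rint (lint f) x.
Proof.
move=> bf x01 f0; have /andP[x0 x1] := x01.
have bF := bmeas_lint bf.
have monF s t : 0 <= s -> s <= t -> t <= 1 -> lint f s <= lint f t.
  move=> s0 st t1; rewrite -subr_ge0.
  have := @ler_lintB _ (fun=> 0) f s t s0 st t1 (bmeas_cst 0) bf.
  have t0 := le_trans s0 st.
  rewrite (lint_cst _ t0) (lint_cst _ s0) !mul0r subrr; apply => u /andP[su ut].
  by apply: f0; rewrite (le_trans s0 su) (le_trans ut t1).
have A : lint (lint f) x <= lint f x * x.
  rewrite -[leRHS](lint_cst _ x0); apply: ler_lint => //.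
    exact: bmeas_cst.
  by move=> t /andP[t0 tx]; apply: monF.
have B : lint f x * (1 - x) <= rint (lint f) x.
  have -> : lint f x * (1 - x) = rint (fun=> lint f x) x.
    by rewrite /rint !lint_cst ?ler01//; ring.
  apply: ler_rint => //; first exact: bmeas_cst.
  by move=> t /andP[xt t1]; apply: monF.
rewrite /rint in B *; set I1 := lint (lint f) 1 in B *.
set I2 := lint (lint f) x in A B *; set u := lint f x in A B.
have : (1 - x) * I2 <= (1 - x) * (u * x) by rewrite ler_wpM2l ?subr_ge0.
have : x * (u * (1 - x)) <= x * (I1 - I2) by rewrite ler_wpM2l.
lra.
Qed.

Lemma bmeas_monom c (k : nat) : bmeas (fun t : R => c * (1 - t) ^+ k).
Proof.
apply: continuous_bmeas; apply: is_derive_continuous => t.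
apply: is_derive_mulc; exact: is_derive_onem_exp.
Qed.

(* The lower bounds spread from [y true false] to all four types in four
   steps, and they are proportional to [theta y]. *)
Lemma iterKop4_ge y p q x : bfam y -> lefam zfam y -> 0 <= x <= 1 ->
  theta y / 8 * prof p q x <= iter 4 Kop y p q x.
Proof.
move=> by_ y0 x01.
have [B BE] : exists B, B = lint (y true false) by exists (lint (y true false)).
have [t tE] : exists t, t = theta y by exists (theta y).
have bB : bmeas B by rewrite BE; exact: bmeas_lint.
have y1_0 := Kop_ge0 by_ y0; have b1 := bfam_Kop by_.
have y2_0 := Kop_ge0 b1 y1_0; have b2 := bfam_Kop b1.
have y3_0 := Kop_ge0 b2 y2_0; have b3 := bfam_Kop b2.
have ge0 z p' q' s : lefam zfam z -> 0 <= s <= 1 -> 0 <= z p' q' s.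
  by move=> z0 s01; apply: z0.
have lpos (f : R -> R) s : bmeas f -> 0 <= s <= 1 ->
    (forall u, 0 <= u <= 1 -> 0 <= f u) -> 0 <= lint f s.
  move=> bf s01 f0; have /andP[s0 s1] := s01.
  rewrite -[leLHS](mul0r s) -(lint_cst _ s0); apply: ler_lint => //.
    exact: bmeas_cst.
  by move=> u /andP[u0 us]; apply: f0; rewrite u0 (le_trans us).
have rpos (f : R -> R) s : bmeas f -> 0 <= s <= 1 ->
    (forall u, 0 <= u <= 1 -> 0 <= f u) -> 0 <= rint f s.
  move=> bf s01 f0; have /andP[s0 s1] := s01.
  have -> : 0 = rint (fun=> 0 : R) s.
    by rewrite /rint !lint_cst ?ler01// !mul0r subrr.
  apply: ler_rint => //; first exact: bmeas_cst.
  by move=> u /andP[us u1]; apply: f0; rewrite u1 (le_trans s0 us).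
have le_l (f h : R -> R) s : bmeas f -> bmeas h -> 0 <= s <= 1 ->
    (forall u, 0 <= u <= 1 -> f u <= h u) -> lint f s <= lint h s.
  move=> bf bh s01 fh; apply: ler_lint => // u /andP[u0 us].
  by apply: fh; rewrite u0 (le_trans us)//; case/andP: s01.
have le_r (f h : R -> R) s : bmeas f -> bmeas h -> 0 <= s <= 1 ->
    (forall u, 0 <= u <= 1 -> f u <= h u) -> rint f s <= rint h s.
  move=> bf bh s01 fh; apply: ler_rint => // u /andP[su u1].
  by apply: fh; rewrite u1 andbT; apply: le_trans su; case/andP: s01.
have Y1 q' s : 0 <= s <= 1 -> B s <= Kop y false q' s.
  move=> s01; rewrite BE /Kop /= -[leLHS]addr0; apply: lerD => //.
  by case: q' => //=; apply: rpos => // u u01; apply: ge0.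
have HB s : 0 <= s <= 1 -> t * (1 - s) <= rint B s.
  by move=> s01; rewrite BE tE; apply: theta_le_rint => // u u01; apply: ge0.
have Y2T q' s : 0 <= s <= 1 -> t * (1 - s) <= Kop (Kop y) true q' s.
  move=> s01; apply: le_trans (HB _ s01) _.
  rewrite {1}/Kop /= -[leLHS]add0r; apply: lerD.
    by case: q' => //=; apply: lpos => // u u01; apply: ge0.
  by apply: le_r => // u u01; apply: Y1.
have Y2c s : 0 <= s <= 1 -> t * (1 - s) <= Kop (Kop y) false true s.
  move=> s01; apply: le_trans (HB _ s01) _.
  rewrite {1}/Kop /= -[leLHS]add0r; apply: lerD.
    by apply: lpos => // u u01; apply: ge0.
  by apply: le_r => // u u01; apply: Y1.
have bt k : bmeas (fun s : R => t * (1 - s) ^+ k) by exact: bmeas_monom.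
have lintt k s : 0 <= s <= 1 ->
    lint (fun s => t * (1 - s) ^+ k) s = t * ((1 - (1 - s) ^+ k.+1) / k.+1%:R).
  move=> s01; have /andP[s0 _] := s01; rewrite -lint_monom//.
  transitivity (lint (fun s => t * (1 - s) ^+ k + 0 * 0) s).
    by congr lint; apply/funext => u; rewrite mul0r addr0.
  rewrite lint_lin// ?mul0r ?addr0//; last exact: bmeas_cst.
  have := bmeas_monom 1 k; congr bmeas; apply/funext => u.
  by rewrite mul1r.
have rintt k s : 0 <= s <= 1 ->
    rint (fun s => t * (1 - s) ^+ k) s = t * ((1 - s) ^+ k.+1 / k.+1%:R).
  move=> s01; rewrite /rint !lintt ?ler01 ?lexx//.
  by rewrite subrr expr0n/=; ring.
have t0 : 0 <= t.
  rewrite tE /theta -BE; apply: (lpos _ 1 bB); rewrite ?ler01 ?lexx// => u u01.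
  by rewrite BE; apply: lpos => // v v01; apply: ge0.
have Y3F q' s : 0 <= s <= 1 ->
    t * (s - s ^+ 2 / 2) <= Kop (Kop (Kop y)) false q' s.
  move=> s01; rewrite {1}/Kop /= -[leLHS]addr0; apply: lerD; last first.
    by case: q' => //=; apply: rpos => // u u01; apply: ge0.
  apply: (@le_trans _ _ (lint (fun s => t * (1 - s) ^+ 1) s)).
    by rewrite lintt//; lra.
  by apply: le_l => // u u01; apply: Y2T.
have Y3a s : 0 <= s <= 1 -> t * ((1 - s) ^+ 2 / 2) <= Kop (Kop (Kop y)) true true s.
  move=> s01; rewrite {1}/Kop /= add0r -rintt//.
  by apply: le_r => // u u01; apply: Y2c.
have Y3b s : 0 <= s <= 1 -> t * (1 / 2) <= Kop (Kop (Kop y)) true false s.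
  move=> s01; rewrite {1}/Kop /=.
  have -> : t * (1 / 2) = lint (fun s => t * (1 - s) ^+ 1) s +
                          rint (fun s => t * (1 - s) ^+ 1) s.
    by rewrite lintt// rintt//; ring.
  apply: lerD.
    apply: (le_l _ _ _ (bt 1%N) (b2 true true) s01) => u u01.
    by rewrite expr1; exact: Y2T.
  apply: (le_r _ _ _ (bt 1%N) (b2 false true) s01) => u u01.
  by rewrite expr1; exact: Y2c.
have hints s : 0 <= s <= 1 ->
    [/\ 0 <= t * s, 0 <= t * (1 - s) & 0 <= t * (s * (1 - s))].
  by case/andP => s0 s1; rewrite !mulr_ge0 ?subr_ge0.
(* The concave profile s - s^2/2 is replaced by its chord s/2, written with the monomials in 1 -
   s. *)
have half s : 0 <= s <= 1 -> t * (1 / 2) - t * (1 / 2) * (1 - s) ^+ 1 <= t * (s - s ^+ 2 / 2).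
  by case/hints => h1 h2 h3; lra.
have Y4r q' s : 0 <= s <= 1 ->
    t * ((1 - s ^+ 2) / 4) <= rint (Kop (Kop (Kop y)) false q') s.
  move=> s01; apply: (@le_trans _ _ (rint (fun u => 1 * (t * (1 / 2)) + (- 1 / 2) * (t * (1 - u) ^+ 1)) s)).
    rewrite (rint_lin (g := fun=> t * (1 / 2)))//; last exact: bmeas_cst.
    have /andP[s0 s1] := s01.
    rewrite rintt// /rint !lint_cst ?ler01//; lra.
  apply: (le_r _ _ _ (bmeas_lin _ _ (bmeas_cst _) (bt 1%N)) (b3 _ _) s01).
  move=> u u01; apply: le_trans (Y3F q' _ u01); have := half _ u01; lra.
have /andP[x0 x1] := x01; have [h1 h2 h3] := hints _ x01.
have -> : iter 4 Kop y = Kop (Kop (Kop (Kop y))) by [].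
rewrite {1}/Kop /prof -tE; case: p; case: q => /=.
- rewrite add0r; apply: le_trans (Y4r _ _ x01); lra.
(* This type gives the smallest constant: the bound equals 1/6 at x = 1, so that 1/8 serves for all
   types. *)
- apply: (@le_trans _ _ (t * (1 / 2) * ((1 - (1 - x) ^+ 3) / 3) + t * ((1 - x ^+ 2) / 4))).
    have : 0 <= (1 - x ^+ 2) / 4 + (1 - (1 - x) ^+ 3) / 6 - 1 / 8.
      have -> : (1 - x ^+ 2) / 4 + (1 - (1 - x) ^+ 3) / 6 - 1 / 8 =
         (1 - x) / 8 + x / 24 + x * (1 - x) * (7 / 12 - x / 6) by field.
      have h4 : 0 <= x * (1 - x) * (7 / 12 - x / 6).
        by rewrite !mulr_ge0 ?subr_ge0//; lra.
      by lra.
    by move=> /(mulr_ge0 t0) h4; lra.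
  apply: lerD; last exact: Y4r.
  have -> : t * (1 / 2) * ((1 - (1 - x) ^+ 3) / 3) =
      lint (fun u => 1 / 2 * (t * (1 - u) ^+ 2) + 0 * 0) x.
    rewrite lint_lin// ?lintt//; last exact: bmeas_cst.
    by rewrite mul0r addr0; ring.
  apply: (le_l _ _ _ (bmeas_lin _ _ (bt 2%N) (bmeas_cst _)) (b3 _ _) x01).
  by move=> u u01; apply: le_trans (Y3a _ u01); rewrite mul0r addr0; lra.
- apply: (@le_trans _ _ (t * (1 / 2) * x + t * ((1 - x ^+ 2) / 4))); first by lra.
  apply: lerD; last exact: Y4r.
  rewrite -lint_cst//; apply: le_l => //; first exact: bmeas_cst.
- rewrite addr0; apply: (@le_trans _ _ (t * (1 / 2) * x)); first by lra.
  rewrite -lint_cst//; apply: le_l => //; first exact: bmeas_cst.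
Qed.

(** With [prof_le_phi], this bounds every image [Kop y] by a multiple of phi, which may fail for y
    itself because of the zeros of phi. *)
Lemma normr_Kop_le y M p q x : bfam y -> 0 <= x <= 1 ->
  (forall p q x, 0 <= x <= 1 -> `|y p q x| <= M) ->
  `|Kop y p q x| <= M * prof p q x.
Proof.
move=> by_ x01 yM; have /andP[x0 x1] := x01.
have L (f : R -> R) : bmeas f -> (forall t, 0 <= t <= 1 -> `|f t| <= M) ->
    `|lint f x| <= M * x /\ `|rint f x| <= M * (1 - x).
  move=> bf fM; have rc c : rint (fun=> c) x = c * (1 - x).
    by rewrite /rint !lint_cst ?ler01//; ring.
  have fM' t : 0 <= t <= 1 -> - M <= f t <= M.
    by move=> t01; rewrite -ler_norml fM.
  have bc (c : R) := bmeas_cst c.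
  split; rewrite ler_norml -mulNr; apply/andP; split.
  - rewrite -(lint_cst _ x0); apply: (ler_lint x01 (bc _) bf) => t /andP[t0 tx].
    by have /andP[] := fM' t (introT andP (conj t0 (le_trans tx x1))).
  - rewrite -(lint_cst _ x0); apply: (ler_lint x01 bf (bc _)) => t /andP[t0 tx].
    by have /andP[] := fM' t (introT andP (conj t0 (le_trans tx x1))).
  - rewrite -rc; apply: (ler_rint x01 (bc _) bf) => t /andP[xt t1].
    by have /andP[] := fM' t (introT andP (conj (le_trans x0 xt) t1)).
  - rewrite -rc; apply: (ler_rint x01 bf (bc _)) => t /andP[xt t1].
    by have /andP[] := fM' t (introT andP (conj (le_trans x0 xt) t1)).
have [L1 _] := L _ (by_ true p) (yM true p).
have [_ R1] := L _ (by_ false p) (yM false p).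
rewrite /Kop /prof; case: p L1 R1; case: q => //= L1 R1.
- by rewrite add0r.
- by apply: le_trans (ler_normD _ _) _; lra.
- by apply: le_trans (ler_normD _ _) _; lra.
- by rewrite addr0.
Qed.

End Transfer.

(** * Contraction towards the positive eigenfamily *)

Section Contraction.
Context {R : realType}.
Local Notation fam := (bool -> bool -> R -> R).
Variables (phi : fam) (lam : R).
Hypothesis bphi : bfam phi.
Hypothesis lam_gt0 : 0 < lam.
Hypothesis phi_ge0 : lefam zfam phi.
Hypothesis eig : forall p q x, 0 <= x <= 1 -> Kop phi p q x = lam * phi p q x.
Hypothesis theta_gt0 : 0 < theta phi.
Implicit Types (y : fam) (m M : R).

Definition scal m : fam := lcomb m phi 0 phi.

Lemma scalE m p q x : scal m p q x = m * phi p q x.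
Proof. by rewrite /scal /lcomb mul0r addr0. Qed.

Lemma bfam_scal m : bfam (scal m).
Proof. exact: bfam_lcomb. Qed.

Lemma iterKop_eig n p q x : 0 <= x <= 1 ->
  iter n Kop phi p q x = lam ^+ n * phi p q x.
Proof.
elim: n p q x => [|n IH] p q x x01; first by rewrite expr0 mul1r.
rewrite iterS (eq_Kop (z := scal (lam ^+ n)))//; last first.
  by move=> *; rewrite scalE IH.
by rewrite Kop_lcomb// mul0r addr0 eig// exprS; ring.
Qed.

Lemma bfam_bound y : bfam y ->
  exists2 M : R, 0 < M & forall p q x, 0 <= x <= 1 -> `|y p q x| <= M.
Proof.
move=> by_; have [_ [A HA]] := by_ true true; have [_ [B HB]] := by_ true false.
have [_ [C HC]] := by_ false true; have [_ [D HD]] := by_ false false.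
exists (1 + `|A| + `|B| + `|C| + `|D|).
  by do 4 (apply: ltr_wpDr; first exact: normr_ge0).
have := (ler_norm A, ler_norm B, ler_norm C, ler_norm D).
have := (normr_ge0 A, normr_ge0 B, normr_ge0 C, normr_ge0 D).
move=> [[[a1 b1] c1] d1] [[[a2 b2] c2] d2] [] [] x x01.
- by have := HA x x01; lra.
- by have := HB x x01; lra.
- by have := HC x x01; lra.
- by have := HD x x01; lra.
Qed.

(** Up to the factor lam, phi is its own image under [Kop], so the bound of images by the profile
    applies to it. *)
Lemma phi_le_prof : exists2 C : R, 0 < C &
  forall p q x, 0 <= x <= 1 -> phi p q x <= C * prof p q x.
Proof.
have [M M0 HM] := bfam_bound bphi; exists (M / lam); first exact: divr_gt0.
move=> p q x x01; have := normr_Kop_le p q bphi x01 HM.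
rewrite eig// normrM gtr0_norm// mulrC mulrAC ler_pdivlMr//.
by apply: le_trans; rewrite ler_pM2r// ler_norm.
Qed.

(** This is the minorisation [iterKop4_ge] applied to phi itself, on which the fourth iterate acts
    as lam ^+ 4. *)
Lemma prof_le_phi : exists2 C : R, 0 < C &
  forall p q x, 0 <= x <= 1 -> prof p q x <= C * phi p q x.
Proof.
exists (lam ^+ 4 * (theta phi / 8)^-1) => [|p q x x01].
  by rewrite mulr_gt0 ?exprn_gt0// invr_gt0 divr_gt0.
have := iterKop4_ge p q bphi phi_ge0 x01; rewrite iterKop_eig//.
rewrite mulrC -ler_pdivlMr ?divr_gt0// => /le_trans; apply.
by rewrite mulrAC.
Qed.

(** The minorisation is applied to the nonnegative family y - m phi, and [prof] is then bounded
    below by phi / C. *)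
Lemma iterKop4_scal_ge C y m p q x : 0 < C ->
  (forall p q x, 0 <= x <= 1 -> phi p q x <= C * prof p q x) ->
  bfam y -> lefam (scal m) y -> 0 <= x <= 1 ->
  (m * lam ^+ 4 + (theta y - m * theta phi) / (8 * C)) * phi p q x <=
  iter 4 Kop y p q x.
Proof.
move=> C0 HC by_ my x01; pose z := lcomb 1 y (- m) phi.
have bz : bfam z by exact: bfam_lcomb.
have z0 : lefam zfam z.
  move=> p' q' t t01; rewrite /z /lcomb /zfam mul1r mulNr subr_ge0 -scalE.
  exact: my.
have := iterKop4_ge p q bz z0 x01.
rewrite iterKop_lcomb// iterKop_eig// theta_lcomb// => H.
have tz : 0 <= 1 * theta y + - m * theta phi.
  rewrite -theta_lcomb// -[leLHS]theta0.
  by apply: ler_theta => //; exact: bfam0.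
have := HC p q x x01; rewrite mulrC -ler_pdivrMr// => H2.
have := ler_wpM2l tz H2; rewrite mul1r mulNr in H tz *.
move: H; set w := theta y - m * theta phi.
have -> : w / (8 * C) = w / C / 8 by field; rewrite gt_eqF.
have -> : w * (phi p q x / C) = w / C * phi p q x by ring.
move: (w / C) (w) (lam ^+ 4) (iter 4 Kop y p q x) (prof p q x) (phi p q x).
by move=> A B D E F G; rewrite mul1r => H1 H3; lra.
Qed.

(** Bernoulli's inequality: a contraction by 1 - e over four steps is covered by the rate 1 - e / 4
    per step. *)
Lemma ler_onem_exp4 (e : R) : 0 <= e <= 1 -> 1 - e <= (1 - e / 4) ^+ 4.
Proof.
move=> /andP[e0 e1]; have H (s : R) : 0 <= 1 - s + s ^+ 2 / 4.
  have -> : 1 - s + s ^+ 2 / 4 = (1 - s / 2) ^+ 2 by field.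
  exact: sqr_ge0.
have -> : (1 - e / 4) ^+ 4 = (1 - e / 2 + e ^+ 2 / 16) ^+ 2 by field.
have : 0 <= (1 - e / 2) * (e ^+ 2 / 8) by rewrite mulr_ge0 ?divr_ge0 ?sqr_ge0//; lra.
have := sqr_ge0 (e ^+ 2 / 16); have := sqr_ge0 e.
have -> : (1 - e / 2 + e ^+ 2 / 16) ^+ 2 = 1 - e + e ^+ 2 / 4 +
  (1 - e / 2) * (e ^+ 2 / 8) + (e ^+ 2 / 16) ^+ 2 by field.
by move: ((1 - e / 2) * (e ^+ 2 / 8)) ((e ^+ 2 / 16) ^+ 2) (e ^+ 2) => a b c; lra.
Qed.

(* Both bounds below follow the same recursion [b <- (1 - e) b + eta t_n], so
   their distance shrinks by the factor [1 - e]. *)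
Theorem iterKop_cvg : exists rho : R, [/\ 0 < rho, rho < 1 &
  forall y, bfam y -> exists kappa D : R,
    (forall n p q x, 0 <= x <= 1 ->
      `|iter n Kop y p q x - kappa * lam ^+ n * phi p q x| <=
      D * (rho * lam) ^+ n) /\
    (forall m, lefam (scal m) y -> m <= kappa)].
Proof.
have [C0 C00 HC0] := phi_le_prof; have [C1 C10 HC1] := prof_le_phi.
(* [C] is enlarged so that e <= 1 below, which keeps the factor 1 - e of the recursion
   nonnegative. *)
have [C [C_gt0 HC Cth]] : exists C : R, [/\ 0 < C,
    (forall p q x, 0 <= x <= 1 -> phi p q x <= C * prof p q x) &
    theta phi <= 8 * C * lam ^+ 4].
  have l4 : 0 < lam ^+ 4 by rewrite exprn_gt0.
  exists (C0 + theta phi / (8 * lam ^+ 4)); split.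
  - by rewrite addr_gt0// divr_gt0// mulr_gt0.
  - move=> p q x x01; apply: le_trans (HC0 _ _ _ x01) _.
    apply: ler_wpM2r; last by rewrite lerDl divr_ge0 ?mulr_ge0 ?ltW.
    by rewrite /prof; case: p q => [] [] //=; lra.
  - rewrite mulrDr mulrDl.
    have -> : 8 * (theta phi / (8 * lam ^+ 4)) * lam ^+ 4 = theta phi.
      by field; rewrite gt_eqF.
    by rewrite lerDr !mulr_ge0// ltW.
pose eta := (8 * C * lam ^+ 4)^-1; pose e := eta * theta phi.
have eta_gt0 : 0 < eta by rewrite invr_gt0 !mulr_gt0// exprn_gt0.
have e0 : 0 < e by rewrite mulr_gt0.
have e1 : e <= 1.
  by rewrite /e /eta mulrC ler_pdivrMr ?mul1r// !mulr_gt0// exprn_gt0.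
pose rho := 1 - e / 4.
have rho0 : 0 < rho by rewrite /rho; lra.
have rho1 : rho < 1 by rewrite /rho; lra.
have rho4 : 1 - e <= rho ^+ 4 by apply: ler_onem_exp4; lra.
exists rho; split => // y by_.
(* One application is spent first: y need not be bounded by a multiple of phi, but [Kop y] is. *)
have [W [W0 HW]] : exists W : R, 0 <= W /\
    forall p q x, 0 <= x <= 1 -> `|Kop y p q x| <= W * phi p q x.
  have [M M0 HM] := bfam_bound by_; exists (M * C1); split.
    by rewrite mulr_ge0 ?ltW.
  move=> p q x x01; apply: le_trans (normr_Kop_le p q by_ x01 HM) _.
  by rewrite -mulrA; apply: ler_wpM2l; [exact: ltW|exact: HC1].
pose u n := iter (4 * n) Kop (Kop y).
have bu n : bfam (u n) by apply: bfam_iterKop; exact: bfam_Kop.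
pose t n := theta (u n) / lam ^+ (4 * n).
(* [sq b n * lam ^+ (4 * n)] is the coefficient of phi in the bound for [u n] that starts from b. *)
pose fix sq (b : R) (n : nat) : R :=
  if n is n'.+1 then (1 - e) * sq b n' + eta * t n' else b.
have l_gt0 n : 0 < lam ^+ n by rewrite exprn_gt0.
have sq_lo b : lefam (scal b) (Kop y) ->
    forall n, lefam (scal (sq b n * lam ^+ (4 * n))) (u n).
  move=> Hb; elim=> [|n IH].
    by rewrite muln0 expr0 mulr1.
  move=> p q x x01; rewrite scalE /=.
  have -> : u n.+1 = iter 4 Kop (u n) by rewrite /u mulnS iterD.
  have := iterKop4_scal_ge p q C_gt0 HC (bu n) IH x01.
  suff -> : sq b n * lam ^+ (4 * n) * lam ^+ 4 +
    (theta (u n) - sq b n * lam ^+ (4 * n) * theta phi) / (8 * C) =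
    ((1 - e) * sq b n + eta * t n) * lam ^+ (4 * n.+1) by [].
  rewrite mulnS exprD /e /eta /t; field.
  by rewrite !gt_eqF.
have sq_hi b : lefam (Kop y) (scal b) ->
    forall n, lefam (u n) (scal (sq b n * lam ^+ (4 * n))).
  move=> Hb; elim=> [|n IH].
    by rewrite muln0 expr0 mulr1.
  move=> p q x x01; rewrite scalE /=.
  have -> : u n.+1 = iter 4 Kop (u n) by rewrite /u mulnS iterD.
  (* The upper bound is the lower bound for the opposite of [u n]; as [theta] is linear, the
     recursion is the same. *)
  have bo : bfam (lcomb (-1) (u n) 0 phi) by exact: bfam_lcomb.
  have IH' : lefam (scal (- (sq b n * lam ^+ (4 * n)))) (lcomb (-1) (u n) 0 phi).
    move=> p' q' s s01; rewrite scalE /lcomb mul0r addr0 mulN1r mulNr lerN2.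
    by rewrite -scalE; exact: IH.
  have := iterKop4_scal_ge p q C_gt0 HC bo IH' x01.
  rewrite iterKop_lcomb// theta_lcomb// !mul0r !addr0 !mulN1r.
  suff -> : - (sq b n * lam ^+ (4 * n)) * lam ^+ 4 +
    (- theta (u n) - - (sq b n * lam ^+ (4 * n)) * theta phi) / (8 * C) =
    - (((1 - e) * sq b n + eta * t n) * lam ^+ (4 * n.+1)).
    by rewrite mulNr lerN2.
  rewrite mulnS exprD /e /eta /t; field.
  by rewrite !gt_eqF.
have loW : lefam (scal (- W)) (Kop y).
  move=> p q x x01; rewrite scalE mulNr; have := HW p q x x01.
  by rewrite ler_norml => /andP[].
have hiW : lefam (Kop y) (scal W).
  move=> p q x x01; rewrite scalE; have := HW p q x x01.
  by rewrite ler_norml => /andP[].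
have osc n : sq W n - sq (- W) n = (1 - e) ^+ n * (2 * W).
  elim: n => [|n IH] /=; first by rewrite expr0; ring.
  rewrite exprS -mulrA -IH; ring.
(* All normalised coefficients c that are ever a lower bound are collected, not only those of
   [sq (- W)]; this yields the last clause of the theorem. *)
pose S : set R := [set c | exists n, lefam (scal (c * lam ^+ (4 * n))) (u n)].
have theta_scal c : theta (scal c) = c * theta phi.
  by rewrite /scal theta_lcomb// mul0r addr0.
have sqW_le n : sq W n.+1 <= sq W n.
  have H : t n <= sq W n * theta phi.
    rewrite /t ler_pdivrMr// mulrAC -theta_scal.
    by apply: ler_theta => //; [exact: bfam_scal|exact: sq_hi].
  have H2 : eta * t n <= eta * (sq W n * theta phi) by apply: ler_wpM2l => //; exact: ltW.
  have -> : sq W n = (1 - e) * sq W n + eta * (sq W n * theta phi).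
    by rewrite /e; ring.
  by rewrite -/(sq W n) lerD2l.
have sqW_mono n k : (n <= k)%N -> sq W k <= sq W n.
  elim: k => [|k IH]; first by rewrite leqn0 => /eqP ->.
  rewrite leq_eqVlt => /predU1P[->//|/IH]; exact: le_trans.
have S_step c n k : lefam (scal (c * lam ^+ (4 * n))) (u n) ->
    lefam (scal (c * lam ^+ (4 * (n + k)))) (u (n + k)%N).
  move=> H p q x x01.
  have -> : u (n + k)%N = iter (4 * k) Kop (u n) by rewrite /u mulnDr addnC iterD.
  have := lefam_iterKop (4 * k) (@bfam_scal _) (bu n) H p q x01.
  rewrite iterKop_lcomb// mul0r addr0 iterKop_eig// scalE mulnDr exprD.
  by rewrite !mulrA.
have S_ub k : ubound S (sq W k).
  move=> c [n Hn]; have H := S_step c n k Hn.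
  have := ler_theta (@bfam_scal _) (bu _) H.
  have := ler_theta (bu _) (@bfam_scal _) (sq_hi _ hiW (n + k)%N).
  rewrite !theta_scal => /[swap] /le_trans /[apply].
  rewrite ler_pM2r// ler_pM2r// => /le_trans; apply.
  by apply: sqW_mono; exact: leq_addl.
have S_lo n : S (sq (- W) n) by exists n; exact: sq_lo.
have S_sup : has_sup S by split; [exists (sq (- W) 0); exact: S_lo|exists (sq W 0)].
pose kappa := sup S.
have k_lo n : sq (- W) n <= kappa by apply: ub_le_sup => //; exists (sq W 0).
have k_hi n : kappa <= sq W n by apply: ge_sup => //; exists (sq (- W) 0).
have [My My0 HMy] := bfam_bound by_; have [Mp Mp0 HMp] := bfam_bound bphi.
(* [D0] covers n = 0. In [D1], 2 * W is the initial distance of the two bounds, and the division by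
   rho ^+ 4 pays for rounding n down to a multiple of 4. *)
pose D0 := My + `|kappa / lam| * Mp; pose D1 := 2 * W * Mp / (rho ^+ 4 * lam).
have D00 : 0 <= D0 by rewrite addr_ge0// ?mulr_ge0// ltW.
have D10 : 0 <= D1.
  by rewrite divr_ge0 ?mulr_ge0 ?exprn_ge0// ltW.
(* The division by lam undoes the initial application of [Kop]. *)
exists (kappa / lam), (D0 + D1); split; last first.
  move=> m Hm; rewrite ler_pdivlMr//; apply: ub_le_sup; first by exists (sq W 0).
  exists 0%N => p q x x01; rewrite muln0 expr0 mulr1.
  have := lefam_Kop (@bfam_scal _) by_ Hm p q x01.
  by rewrite Kop_lcomb// mul0r addr0 eig// scalE mulrA.
case=> [|n] p q x x01.
  rewrite !expr0 !mulr1 /=; apply: (@le_trans _ _ D0); last by rewrite lerDl.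
  apply: le_trans (ler_normB _ _) _; apply: lerD; first exact: HMy.
  by rewrite normrM; apply: ler_wpM2l => //; exact: HMp.
apply: (@le_trans _ _ (D1 * (rho * lam) ^+ n.+1)); last first.
  by apply: ler_wpM2r; [rewrite exprn_ge0// mulr_ge0 ?ltW|rewrite lerDr].
have nE := divn_eq n 4; set k := (n %/ 4)%N in nE; set i := (n %% 4)%N in nE.
have i4 : (i <= 4)%N by rewrite ltnW// ltn_mod.
have uE : iter n.+1 Kop y = iter i Kop (u k).
  by rewrite /u -iterD -iterSr mulnC addnC -nE.
have Hlo := lefam_iterKop i (@bfam_scal _) (bu k) (sq_lo _ loW k) p q x01.
have Hhi := lefam_iterKop i (bu k) (@bfam_scal _) (sq_hi _ hiW k) p q x01.
rewrite iterKop_lcomb// mul0r addr0 iterKop_eig// in Hlo.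
rewrite iterKop_lcomb// mul0r addr0 iterKop_eig// in Hhi.
have lnE : lam ^+ n = lam ^+ (4 * k) * lam ^+ i by rewrite -exprD mulnC -nE.
have px0 : 0 <= phi p q x by exact: phi_ge0.
have lp0 : 0 <= lam ^+ n * phi p q x by rewrite mulr_ge0// ltW.
have Hlo' : sq (- W) k * (lam ^+ n * phi p q x) <= iter n.+1 Kop y p q x.
  by rewrite uE; apply: le_trans Hlo; rewrite lnE !mulrA.
have Hhi' : iter n.+1 Kop y p q x <= sq W k * (lam ^+ n * phi p q x).
  by rewrite uE; apply: le_trans Hhi _; rewrite lnE !mulrA.
have kE : kappa / lam * lam ^+ n.+1 * phi p q x = kappa * (lam ^+ n * phi p q x).
  by rewrite exprS; field; rewrite gt_eqF.
rewrite kE.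
apply: (@le_trans _ _ ((sq W k - sq (- W) k) * (lam ^+ n * phi p q x))).
  have h1 := ler_wpM2r lp0 (k_lo k); have h2 := ler_wpM2r lp0 (k_hi k).
  rewrite ler_norml mulrBl; move: h1 h2 Hlo' Hhi'.
  move: (iter _ _ _ _ _ _) (sq (- W) k * _) (sq W k * _) (kappa * _) => a b c d.
  by move=> *; apply/andP; split; lra.
have -> : D1 * (rho * lam) ^+ n.+1 =
    rho ^+ n.+1 / rho ^+ 4 * (2 * W) * (lam ^+ n * Mp).
  by rewrite /D1 exprMn [lam ^+ n.+1]exprS; field; rewrite !gt_eqF.
rewrite osc; apply: ler_pM => //.
- by rewrite !mulr_ge0// exprn_ge0// subr_ge0.
- apply: ler_wpM2r; first by rewrite mulr_ge0.
  rewrite ler_pdivlMr ?exprn_gt0//.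
  apply: (@le_trans _ _ ((rho ^+ 4) ^+ k * rho ^+ i.+1)).
    have e1' : 0 <= 1 - e by rewrite subr_ge0.
    have r0 := ltW rho0; apply: ler_pM; rewrite ?exprn_ge0//.
      by apply: lerXn2r => //; rewrite nnegrE ?exprn_ge0.
    by apply: ler_wiXn2l; rewrite ?(ltW rho1)// ltn_mod.
  by rewrite -exprM -exprD addnS mulnC -nE.
- apply: ler_wpM2l; first exact: ltW.
  by apply: le_trans (HMp p q x x01); exact: ler_norm.
Qed.

End Contraction.

Transparent lint.

(** * The positive eigenfamily *)

Section Hyperbolic.
Context {R : realType}.
Implicit Types x : R.

Definition ch x : R := (expR x + expR (- x)) / 2.
Definition sh x : R := (expR x - expR (- x)) / 2.

Lemma ch_gt0 x : 0 < ch x.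
Proof. by rewrite divr_gt0// addr_gt0// expR_gt0. Qed.

Lemma sh_ge0 x : 0 <= x -> 0 <= sh x.
Proof.
by move=> x0; rewrite divr_ge0// subr_ge0 ler_expR; lra.
Qed.

Lemma sh_gt0 x : 0 < x -> 0 < sh x.
Proof.
by move=> x0; rewrite divr_gt0// subr_gt0 ltr_expR; lra.
Qed.

Lemma ler_sh x y : x <= y -> sh x <= sh y.
Proof.
move=> xy; have h1 : expR x <= expR y by rewrite ler_expR.
have h2 : expR (- y) <= expR (- x) by rewrite ler_expR lerN2.
by rewrite /sh; lra.
Qed.

Lemma chN x : ch (- x) = ch x.
Proof. by rewrite /ch opprK addrC. Qed.

Lemma shN x : sh (- x) = - sh x.
Proof. by rewrite /sh opprK -mulNr opprB. Qed.

Lemma ch2Bsh2 x : ch x ^+ 2 - sh x ^+ 2 = 1.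
Proof.
have H : expR x * expR (- x) = 1 by rewrite -expRD subrr expR0.
have -> : ch x ^+ 2 - sh x ^+ 2 = expR x * expR (- x) by rewrite /ch /sh; field.
exact: H.
Qed.

Lemma expR_ch x : expR x = ch x + sh x.
Proof. by rewrite /ch /sh; field. Qed.

Lemma chM2 x : ch (x *+ 2) = ch x ^+ 2 + sh x ^+ 2.
Proof.
rewrite /ch /sh -mulNrn !mulr2n !expRD.
by field.
Qed.

Lemma shM2 x : sh (x *+ 2) = 2 * (ch x * sh x).
Proof. by rewrite /ch /sh -mulNrn !mulr2n !expRD; field. Qed.

Lemma is_derive_expRN x : is_derive x (1 : R) (fun t : R => expR (- t)) (- expR (- x)).
Proof.
have -> : - expR (- x) = -1 * expR (-1 * x + 0) by rewrite addr0 !mulN1r.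
have -> : (fun t : R => expR (- t)) = (fun t : R => expR (-1 * t + 0)).
  by apply/funext => t; rewrite addr0 mulN1r.
exact: is_derive_affine (is_derive_expR _).
Qed.

Lemma is_derive_ch x : is_derive x (1 : R) ch (sh x).
Proof.
have -> : ch = (fun t : R => 2^-1 * (expR t + expR (- t))).
  by apply/funext => t; rewrite /ch mulrC.
rewrite /sh mulrC; apply: is_derive_mulc.
exact: is_derive_add (is_derive_expR x) (is_derive_expRN x).
Qed.

Lemma is_derive_sh x : is_derive x (1 : R) sh (ch x).
Proof.
have -> : sh = (fun t : R => 2^-1 * (expR t + -1 * expR (- t))).
  by apply/funext => t; rewrite /sh mulrC mulN1r.
have -> : ch x = 2^-1 * (expR x + -1 * - expR (- x)) by rewrite /ch mulrC mulN1r opprK.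
apply: is_derive_mulc; apply: (is_derive_add (is_derive_expR x)).
exact: is_derive_mulc (is_derive_expRN x).
Qed.

End Hyperbolic.

Section Wave.
Context {R : realType}.
Variables s t : R.
Hypothesis s_gt0 : 0 < s.
Hypothesis st1 : s * t = 1.
Hypothesis t2E : t ^+ 2 = s ^+ 2 + 1.

(** As s t = 1 and t^2 = s^2 + 1, this is the general real solution of u'''' + u'' = u, which the
    eigenvalue problem becomes in the rescaled variable w. *)
Definition wave (a b c d : R) (w : R) : R :=
  a * ch (s * w) + b * sh (s * w) + c * cos (t * w) + d * sin (t * w).

Lemma is_derive_wave a b c d w :
  is_derive w (1 : R) (wave a b c d)
    (wave (s * b) (s * a) (t * d) (- (t * c)) w).
Proof.
have -> : wave (s * b) (s * a) (t * d) (- (t * c)) w =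
  a * (s * sh (s * w + 0)) + b * (s * ch (s * w + 0)) +
  c * (t * - sin (t * w + 0)) + d * (t * cos (t * w + 0)).
  by rewrite /wave !addr0; ring.
have -> : wave a b c d = (fun w => a * ch (s * w + 0) + b * sh (s * w + 0) +
    c * cos (t * w + 0) + d * sin (t * w + 0)).
  by apply/funext => x; rewrite !addr0.
apply: is_derive_add; [apply: is_derive_add; [apply: is_derive_add|]|];
  apply: is_derive_mulc; apply: is_derive_affine.
- exact: is_derive_ch.
- exact: is_derive_sh.
Qed.

Lemma waveN a b c d w : wave a b c d (- w) = wave a (- b) c (- d) w.
Proof. by rewrite /wave !mulrN chN shN cosN sinN; ring. Qed.

Lemma continuous_wave_affine a b c d (e f : R) :
  continuous (fun x : R => wave a b c d (e * x + f)).
Proof.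
apply: is_derive_continuous => x; apply: is_derive_affine.
Qed.

(** The vanishing of [Dplus] and of [Dminus] at h are the boundary conditions, for z = 2 h, of the
    eigenfamilies that complementation leaves invariant and changes to their opposites,
    respectively. *)
Definition Dplus (h : R) : R :=
  (s ^+ 2 + t ^+ 2) * (ch (s * h) * cos (t * h) - sh (s * h) * sin (t * h))
  - (t + s) * (ch (s * h) * sin (t * h)) + (t - s) * (sh (s * h) * cos (t * h)).

Definition Dminus (h : R) : R :=
  (s ^+ 2 + t ^+ 2) * (ch (s * h) * cos (t * h) + sh (s * h) * sin (t * h))
  + (t - s) * (ch (s * h) * sin (t * h)) + (t + s) * (sh (s * h) * cos (t * h)).

Lemma t_gt0 : 0 < t.
Proof. by rewrite -(pmulr_rgt0 _ s_gt0) st1. Qed.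

Lemma lt_s_t : s < t.
Proof.
have t0 := t_gt0; rewrite ltNge; apply/negP => ts.
have : t ^+ 2 <= s ^+ 2 by rewrite lerXn2r// nnegrE ltW.
by rewrite t2E; lra.
Qed.

Lemma t_ge1 : 1 <= t.
Proof.
have t0 := t_gt0; rewrite leNgt; apply/negP => t1.
have : t ^+ 2 < 1 by rewrite expr_lt1// ltW.
by rewrite t2E; have := sqr_ge0 s; lra.
Qed.

Lemma Dminus_gt0 h : 0 < h -> t * h <= pi / 2 -> 0 < Dminus h.
Proof.
move=> h0 hp; have t0 := t_gt0; have st := lt_s_t.
have c0 : 0 <= cos (t * h).
  by rewrite cos_ge0_pihalf// hp andbT; have := mulr_gt0 t0 h0; have := pi_gt0 R; lra.
have n0 : 0 < sin (t * h).
  apply: sin_gt0_pi; rewrite mulr_gt0//=; have := pi_gt0 R; lra.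
have C0 := ch_gt0 (s * h); have S0 := sh_gt0 (mulr_gt0 s_gt0 h0).
have q0 : 0 < s ^+ 2 + t ^+ 2 by rewrite addr_gt0// exprn_gt0.
rewrite /Dminus -addrA ltr_wpDl//.
  apply: mulr_ge0; first exact: ltW.
  by apply: addr_ge0; apply: mulr_ge0 => //; exact: ltW.
have ts : 0 < t - s by rewrite subr_gt0.
have ts' : 0 < t + s by rewrite addr_gt0.
apply: ltr_pwDl; first by apply: mulr_gt0 => //; apply: mulr_gt0.
by apply: mulr_ge0; [exact: ltW|apply: mulr_ge0 => //; exact: ltW].
Qed.

Lemma is_derive_Dplus h : is_derive h (1 : R) Dplus
  (- ((s ^+ 2 + t ^+ 2) * (ch (s * h) * cos (t * h) + sh (s * h) * sin (t * h)
     + (s + t) * (ch (s * h) * sin (t * h)) + (t - s) * (sh (s * h) * cos (t * h))))).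
Proof.
have dM (f g : R -> R) (a b : R) : is_derive h (1 : R) f a -> is_derive h (1 : R) g b ->
    is_derive h (1 : R) (fun x => f x * g x) (f h * b + g h * a).
  by move=> df dg; exact: (is_deriveM df dg).
have dl (f : R -> R) (e a : R) : is_derive (e * h + 0) (1 : R) f a ->
    is_derive h (1 : R) (fun x => f (e * x)) (e * a).
  move=> df; have -> : (fun x => f (e * x)) = (fun x => f (e * x + 0)).
    by apply/funext => x; rewrite addr0.
  exact: is_derive_affine.
have dch := dl _ s _ (is_derive_ch _); have dsh := dl _ s _ (is_derive_sh _).
have dc := dl _ t _ (is_derive_cos _); have dn := dl _ t _ (is_derive_sin _).
rewrite !addr0 in dch dsh dc dn.
have D1 := is_derive_mulc (s ^+ 2 + t ^+ 2)
  (is_derive_add (dM _ _ _ _ dch dc) (is_derive_mulc (-1) (dM _ _ _ _ dsh dn))).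
have D2 := is_derive_mulc (- (t + s)) (dM _ _ _ _ dch dn).
have D3 := is_derive_mulc (t - s) (dM _ _ _ _ dsh dc).
have D := is_derive_add (is_derive_add D1 D2) D3.
have := D; congr (is_derive _ _ _ _); last by ring.
by apply/funext => x; rewrite /Dplus; ring.
Qed.

(** At [h2], tan (t h) reaches t ^+ 3. Up to there sin (t h) <= t ^+ 3 cos (t h), the inequality
    behind the positivity of the eigenfunction, and [Dplus] is already negative at [h2], so it has a
    zero before. *)
Variable h2 : R.
Hypothesis h2_gt0 : 0 < h2.
Hypothesis th2 : t * h2 < pi / 2.
Hypothesis tan_h2 : sin (t * h2) = t ^+ 3 * cos (t * h2).

Lemma cos_th_gt0 h : 0 <= h <= h2 -> 0 < cos (t * h).
Proof.
move=> /andP[h0 hh]; have t0 := t_gt0; apply: cos_gt0_pihalf.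
rewrite (le_lt_trans _ th2) ?ler_pM2l// andbT (@lt_le_trans _ _ 0)//.
  by rewrite oppr_lt0 divr_gt0// pi_gt0.
by rewrite mulr_ge0// ltW.
Qed.

Lemma sin_th_ge0 h : 0 <= h <= h2 -> 0 <= sin (t * h).
Proof.
move=> /andP[h0 hh]; have t0 := t_gt0; apply: sin_ge0_pi.
rewrite mulr_ge0 ?(ltW t0)//=; apply: (@le_trans _ _ (pi / 2)).
  by apply: le_trans (ltW th2); rewrite ler_pM2l.
by have := pi_gt0 R; lra.
Qed.

(** Expand sin (t (h2 - h)) >= 0 and replace sin (t h2) by t ^+ 3 cos (t h2). *)
Lemma sin_th_le h : 0 <= h <= h2 -> sin (t * h) <= t ^+ 3 * cos (t * h).
Proof.
move=> hh; have /andP[h0 hh2] := hh.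
have : 0 <= sin (t * (h2 - h)) by apply: sin_th_ge0; rewrite subr_ge0 hh2 gerBl.
rewrite mulrBr sinB tan_h2 mulrAC [X in _ - X]mulrC -mulrBl pmulr_lge0 ?subr_ge0//.
by apply: cos_th_gt0; rewrite ltW//=.
Qed.

(** The derivative is the opposite of a sum of nonnegative terms here. Strict decrease makes the
    zero given by the intermediate value theorem the first one. *)
Lemma Dplus_decr h h' : 0 <= h -> h < h' -> h' <= h2 -> Dplus h' < Dplus h.
Proof.
move=> h0 hh' h'2.
have cD : continuous Dplus by exact: is_derive_continuous is_derive_Dplus.
have [|c + E] := MVT hh' (fun x _ => is_derive_Dplus x).
  exact: continuous_subspaceT.
rewrite in_itv/= => /andP[hc ch']; have c0 : 0 < c by exact: le_lt_trans hc.
have c2 : 0 <= c <= h2 by rewrite ltW//= (le_trans _ h'2)// ltW.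
rewrite -subr_lt0 E mulNr oppr_lt0 mulr_gt0 ?subr_gt0//.
have t0 := t_gt0; have st := lt_s_t.
have C0 := ch_gt0 (s * c); have S0 := sh_gt0 (mulr_gt0 s_gt0 c0).
have co := cos_th_gt0 c2; have si := sin_th_ge0 c2.
rewrite mulr_gt0//; first by rewrite addr_gt0// exprn_gt0.
have ts : 0 <= t - s by rewrite subr_ge0 ltW.
have ts' : 0 <= s + t by rewrite addr_ge0// ltW.
apply: ltr_wpDr.
  by apply: mulr_ge0 => //; apply: mulr_ge0; exact: ltW.
apply: ltr_wpDr.
  by apply: mulr_ge0 => //; apply: mulr_ge0 => //; exact: ltW.
apply: ltr_pwDl; first exact: mulr_gt0.
by apply: mulr_ge0 => //; exact: ltW.
Qed.

Lemma Dplus0 : 0 < Dplus 0.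
Proof.
rewrite /Dplus !mulr0 cos0 sin0 /sh /ch oppr0 expR0.
rewrite (_ : _ + _ = s ^+ 2 + t ^+ 2); last by field.
by rewrite addr_gt0// exprn_gt0// t_gt0.
Qed.

Lemma Dplus_h2 : Dplus h2 < 0.
Proof.
have t0 := t_gt0; have st := lt_s_t; have t1 := t_ge1.
have hh : 0 <= h2 <= h2 by rewrite lexx ltW.
have c0 := cos_th_gt0 hh; have C0 := ch_gt0 (s * h2).
have S0 := sh_gt0 (mulr_gt0 s_gt0 h2_gt0).
have -> : Dplus h2 = - (cos (t * h2) * (ch (s * h2) * (t ^+ 2 * t ^+ 2 + s * t * t ^+ 2 - s ^+ 2 - t ^+ 2)
   + sh (s * h2) * (s * (s * t) * t ^+ 2 + t ^+ 5 - t + s))).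
  by rewrite /Dplus tan_h2; ring.
rewrite st1 oppr_lt0 mulr_gt0// ltr_wpDl//.
  by rewrite mulr_ge0 ?(ltW C0)// t2E; have := sqr_ge0 s; have := sqr_ge0 (s ^+ 2); lra.
rewrite mulr_gt0// mulr1.
have : 0 <= s * t ^+ 2 by rewrite mulr_ge0 ?exprn_ge0// ltW.
have : t <= t ^+ 5 by rewrite -[leLHS]expr1; apply: ler_weXn2l.
by move: (t ^+ 5) (s * t ^+ 2) => x y xt y0; move: s_gt0; lra.
Qed.

Lemma Dplus_root : exists2 h0, 0 < h0 < h2 & Dplus h0 = 0.
Proof.
have cD : continuous Dplus by exact: is_derive_continuous is_derive_Dplus.
have [||h0 + D0] := @IVT _ Dplus 0 h2 0 (ltW h2_gt0).
- exact: continuous_subspaceT.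
- by rewrite ge_min le_max (ltW Dplus_h2) (ltW Dplus0) orbT.
rewrite in_itv/= => /andP[h00 h02]; exists h0 => //.
rewrite !lt_neqAle h00 h02 !andbT; apply/andP; split; apply/eqP => E.
  by have := Dplus0; rewrite [X in Dplus X]E D0 ltxx.
by have := Dplus_h2; rewrite -E D0 ltxx.
Qed.

Lemma Dplus_gt0 h0 h : Dplus h0 = 0 -> 0 <= h -> h < h0 -> h0 <= h2 -> 0 < Dplus h.
Proof. by move=> E h_ge0 lt_h le_h; rewrite -E; apply: Dplus_decr. Qed.

Lemma t3E : t ^+ 3 = s + t.
Proof.
have -> : t ^+ 3 = t * t ^+ 2 by ring.
by rewrite t2E mulrDr mulr1 -[X in _ = X + _]mulr1 -st1; ring.
Qed.

Lemma s3E : s ^+ 3 = t - s.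
Proof.
have -> : s ^+ 3 = s * t ^+ 2 - s by rewrite t2E; ring.
by rewrite expr2 mulrA st1 mul1r.
Qed.

Variable h0 : R.
Hypothesis h0_gt0 : 0 < h0.
Hypothesis h0_lt : h0 < h2.
Hypothesis Dplus_h0 : Dplus h0 = 0.

Let al := - (cos (t * h0) - s ^+ 3 * sin (t * h0)).
Let be := ch (s * h0) + t ^+ 3 * sh (s * h0).
Let z := 2 * h0.

(* With w = z x - h0, the eigenfunction is [awave] for two ascents and [bwave]
   for an ascent followed by a descent; [uwave] is a primitive of [awave].  The
   choice of [al] and [be] makes [uwave] vanish at x = 0 and, by [Dplus_h0],
   [awave] vanish at x = 1. *)
Definition uwave := wave al (- (al * t ^+ 3)) be (be * s ^+ 3).
Definition awave := wave (- (al * t ^+ 2)) (al * s) (be * s ^+ 2) (- (be * t)).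
Definition bwave := wave (- (al * s ^+ 2)) (- (al * t)) (be * t ^+ 2) (- (be * s)).

(** With the two derivatives below, this is the eigenvalue equation in differential form: an ascent
    followed by a descent collects a primitive of [awave] and one of the reflected [bwave], which is
    [awave] again. *)
Lemma bwaveE w : bwave w = uwave w + awave w.
Proof.
have t0 := t_gt0; rewrite /bwave /uwave /awave /wave t3E s3E t2E; ring.
Qed.

Lemma is_derive_uwave w : is_derive w (1 : R) uwave (awave w).
Proof.
have := is_derive_wave al (- (al * t ^+ 3)) be (be * s ^+ 3) w.
congr (is_derive _ _ _ _); rewrite /awave.
have -> : s * - (al * t ^+ 3) = - (al * (s * t * t ^+ 2)) by ring.
have -> : t * (be * s ^+ 3) = be * (s * t * s ^+ 2) by ring.
by rewrite st1 !mul1r [s * al]mulrC [t * be]mulrC.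
Qed.

Lemma is_derive_awaveN w : is_derive w (1 : R) (fun w => awave (- w)) (bwave w).
Proof.
have := is_derive_wave (- (al * t ^+ 2)) (- (al * s)) (be * s ^+ 2) (be * t) w.
congr (is_derive _ _ _ _).
  by apply/funext => v; rewrite /awave waveN opprK.
have -> : s * - (al * s) = - (al * s ^+ 2) by ring.
have -> : s * - (al * t ^+ 2) = - (al * (s * t * t)) by ring.
have -> : t * (be * s ^+ 2) = be * (s * t * s) by ring.
have -> : t * (be * t) = be * t ^+ 2 by ring.
by rewrite st1 !mul1r.
Qed.

Lemma uwave_left : uwave (- h0) = 0.
Proof.
rewrite /uwave waveN /wave /al /be; ring.
Qed.

Lemma awave_right : awave h0 = 0.
Proof.
rewrite -[RHS]Dplus_h0 /awave /wave /al /be /Dplus.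
have -> : forall C S c n : R, - (- (c - s ^+ 3 * n) * t ^+ 2) * C +
  - (c - s ^+ 3 * n) * s * S + (C + t ^+ 3 * S) * s ^+ 2 * c +
  - ((C + t ^+ 3 * S) * t) * n =
  (s ^+ 2 + t ^+ 2) * (C * c) - (s * t * (s * t) * s + t) * (C * n)
  + (s * t * (s * t) * t - s) * (S * c)
  + (s ^+ 2 * s ^+ 2 - t ^+ 2 * t ^+ 2) * (S * n) by move=> C S c n; ring.
rewrite st1 !mul1r.
have -> : s ^+ 2 * s ^+ 2 - t ^+ 2 * t ^+ 2 = - (s ^+ 2 + t ^+ 2).
  by rewrite t2E; ring.
by ring.
Qed.

Lemma al_le0 : al <= 0.
Proof.
have hh : 0 <= h0 <= h2 by rewrite !ltW.
have := sin_th_le hh; rewrite /al oppr_le0 subr_ge0 => H.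
have : s ^+ 3 * sin (t * h0) <= s ^+ 3 * (t ^+ 3 * cos (t * h0)).
  by rewrite ler_wpM2l// exprn_ge0// ltW.
by rewrite mulrA -exprMn st1 expr1n mul1r.
Qed.

(** Here al <= 0 <= be. For w >= 0 the hyperbolic terms are nonnegative, and [sin_th_le] settles the
    trigonometric ones. For w = - r the only negative term is the one in sh, and the cosine absorbs
    it: - al <= cos (t r) and t sh (s r) <= be t^2. *)
Lemma bwave_ge0 w : - h0 <= w <= h0 -> 0 <= bwave w.
Proof.
have hh : 0 <= h0 <= h2 by rewrite !ltW.
have t0 := t_gt0; have t1 := t_ge1; have al0 := al_le0.
have S0 : 0 <= sh (s * h0) by rewrite sh_ge0// mulr_ge0// ltW.
have be0 : 0 <= be.
  by rewrite addr_ge0 ?(ltW (ch_gt0 _))// mulr_ge0// exprn_ge0// ltW.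
have C0 := ltW (ch_gt0 (s * w)).
have first : 0 <= - (al * s ^+ 2) * ch (s * w).
  by rewrite mulr_ge0// -mulNr mulr_ge0 ?oppr_ge0// sqr_ge0.
move=> /andP[w1 w2]; rewrite /bwave /wave.
have [w0|w0] := leP 0 w.
  have hw : 0 <= w <= h2 by rewrite w0 (le_trans w2)// ltW.
  have Sw : 0 <= sh (s * w) by rewrite sh_ge0// mulr_ge0// ltW.
  have : 0 <= - (al * t) * sh (s * w).
    by rewrite mulr_ge0// -mulNr mulr_ge0 ?oppr_ge0// ltW.
  have : 0 <= be * (s * (t ^+ 3 * cos (t * w) - sin (t * w))).
    apply: mulr_ge0 => //; apply: mulr_ge0; first exact: ltW.
    by rewrite subr_ge0 sin_th_le.
  have -> : be * (s * (t ^+ 3 * cos (t * w) - sin (t * w))) =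
    be * (s * t * t ^+ 2) * cos (t * w) + - (be * s) * sin (t * w) by ring.
  rewrite st1 mul1r => H1 H2; rewrite -addrA addr_ge0// addr_ge0//.
have [r rE] : exists r, w = - r by exists (- w); rewrite opprK.
have r0 : 0 <= r by move: w0; rewrite rE oppr_lt0 => /ltW.
have rh : r <= h0 by move: w1; rewrite rE lerN2.
have hr : 0 <= r <= h2 by rewrite r0 (le_trans rh)// ltW.
have := first; rewrite rE !mulrN chN shN cosN sinN => first'.
have sr := sin_th_ge0 hr; have cr := ltW (cos_th_gt0 hr).
have Sr : 0 <= sh (s * r) by rewrite sh_ge0// mulr_ge0// ltW.
have A1 : - al <= cos (t * r).
  have : cos (t * h0) <= cos (t * r).
    have I h : 0 <= h <= h2 -> t * h \in `[0, pi].
      move=> /andP[h_ge0 h_le]; rewrite in_itv/= mulr_ge0 ?(ltW t0)//=.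
      have : t * h <= t * h2 by rewrite ler_pM2l.
      have := th2; have := pi_gt0 R; lra.
    by rewrite leNgt ltr_cos ?I// -leNgt ler_pM2l.
  rewrite opprK; apply: le_trans; rewrite gerBl mulr_ge0 ?exprn_ge0 ?(ltW s_gt0)//.
  exact: sin_th_ge0.
have B1 : t * sh (s * r) <= be * t ^+ 2.
  have : t ^+ 3 * sh (s * r) <= be.
    apply: (@le_trans _ _ (t ^+ 3 * sh (s * h0))); last by rewrite lerDr ltW// ch_gt0.
    by rewrite ler_wpM2l ?exprn_ge0 ?(ltW t0)// ler_sh// ler_pM2l.
  move=> /(ler_wpM2r (sqr_ge0 t)); apply: le_trans.
  rewrite mulrAC -exprD; apply: ler_wpM2r => //.
  by rewrite -[leLHS]expr1; apply: ler_weXn2l.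
have : - al * (t * sh (s * r)) <= cos (t * r) * (be * t ^+ 2).
  by apply: ler_pM => //; [rewrite oppr_ge0|rewrite mulr_ge0// ltW].
have : 0 <= be * s * sin (t * r) by rewrite !mulr_ge0// ltW.
move: first' => {first}; move: (al) (be) (ch _) (sh _) (cos _) (sin _) => a b C S c n.
by lra.
Qed.

(** The types with p false are those with p true at - w, which makes the family invariant under
    complementation. The argument runs over [- h0, h0] as x runs over [0, 1]. *)
Definition peigen : bool -> bool -> R -> R := fun p q x =>
  (if p == q then awave else bwave) (if p then z * x + - h0 else - z * x + h0).

Let z_gt0 : 0 < z. Proof. by rewrite mulr_gt0. Qed.

Lemma bfam_peigen : bfam peigen.
Proof.
by case; case; rewrite /peigen /=; apply: continuous_bmeas;
  apply: continuous_wave_affine.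
Qed.

Lemma lint_affine (g G : R -> R) (e f x : R) : e != 0 -> 0 <= x ->
  (forall w, is_derive w (1 : R) G (g w)) -> continuous (fun x => g (e * x + f)) ->
  lint (fun x => g (e * x + f)) x = e^-1 * (G (e * x + f) - G f).
Proof.
move=> e0 x0 dG cg.
have dG' (x' : R) : is_derive x' (1 : R) (fun x => e^-1 * G (e * x + f)) (g (e * x' + f)).
  have -> : g (e * x' + f) = e^-1 * (e * g (e * x' + f)) by rewrite mulKf.
  by apply: is_derive_mulc; apply: is_derive_affine.
by rewrite (lint_derive x0 cg dG') mulr0 add0r mulrBr.
Qed.

Lemma lint_peigen x : 0 <= x -> [/\
  lint (peigen true true) x = z^-1 * uwave (z * x - h0),
  lint (peigen true false) x = z^-1 * awave (- z * x + h0),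
  lint (peigen false true) x = - z^-1 * (awave (z * x - h0) - awave (- h0)) &
  lint (peigen false false) x = - z^-1 * (uwave (- z * x + h0) - uwave h0)].
Proof.
move=> x0; have zn : z != 0 by rewrite gt_eqF.
have zn' : - z != 0 by rewrite oppr_eq0.
have arg : z * x - h0 = - (- z * x + h0) by ring.
have arg' : - z * x + h0 = - (z * x - h0) by ring.
split; rewrite /peigen /=.
- rewrite (lint_affine _ _ is_derive_uwave) ?uwave_left ?subr0//.
  exact: continuous_wave_affine.
- rewrite (lint_affine _ _ is_derive_awaveN)//; last exact: continuous_wave_affine.
  by rewrite opprK awave_right subr0 -arg'.
- rewrite (lint_affine _ _ is_derive_awaveN)//; last exact: continuous_wave_affine.
  by rewrite invrN -arg.
- rewrite (lint_affine _ _ is_derive_uwave)//; last exact: continuous_wave_affine.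
  by rewrite invrN.
Qed.

Lemma Kop_peigen p q x : 0 <= x <= 1 -> Kop peigen p q x = z^-1 * peigen p q x.
Proof.
move=> /andP[x0 x1]; have [L1 L2 L3 L4] := lint_peigen x0.
have [M1 M2 M3 M4] := lint_peigen ler01.
have e1 : - z * 1 + h0 = - h0 by rewrite /z; ring.
have e2 : z * 1 - h0 = h0 by rewrite /z; ring.
rewrite /Kop /rint; case: p; case: q; rewrite /=.
- rewrite L3 M3 e2 awave_right /peigen/=; ring.
- rewrite L1 L3 M3 e2 awave_right /peigen/= bwaveE; ring.
- rewrite L2 L4 M4 e1 uwave_left /peigen/= bwaveE; ring.
- rewrite addr0 L2 /peigen/=; ring.
Qed.

(** Only [bwave] requires an analysis of signs: the eigenvalue equation gives the types of two equal
    signs as positive multiples of primitives of the other two. *)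
Lemma peigen_ge0 : lefam zfam peigen.
Proof.
have bb q : forall x, 0 <= x <= 1 -> 0 <= peigen q (~~ q) x.
  by case: q => x /andP[x0 x1]; rewrite /peigen/=; apply: bwave_ge0;
    have := ler_wpM2l (ltW z_gt0) x1; have := mulr_ge0 (ltW z_gt0) x0; rewrite /z;
    lra.
have aa q x : 0 <= x <= 1 -> 0 <= peigen q q x.
  have zi : 0 < z^-1 by rewrite invr_gt0.
  move=> x01; have /andP[x0 x1] := x01; rewrite -(pmulr_rge0 _ zi).
  rewrite -Kop_peigen// /Kop; case: q => /=.
    rewrite add0r (_ : 0 = rint (fun=> 0 : R) x); last first.
      by rewrite /rint !lint_cst ?ler01// !mul0r subrr.
    apply: ler_rint => //; [exact: bmeas_cst|exact: bfam_peigen|].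
    by move=> t' /andP[xt t1]; apply: (bb false); rewrite t1 (le_trans x0).
  rewrite addr0 (_ : 0 = lint (fun=> 0 : R) x); last by rewrite lint_cst// mul0r.
  apply: ler_lint => //; [exact: bmeas_cst|exact: bfam_peigen|].
  by move=> t' /andP[t0' tx]; apply: (bb true); rewrite t0' (le_trans tx).
by move=> [] [] x x01; [exact: aa|exact: (bb true)|exact: (bb false)|exact: aa].
Qed.

(** The primitive of the type [true false] is the type [false false] divided by z, so theta equals
    [uwave h0] divided by z^2; both terms of [uwave h0] are nonnegative and one is positive. *)
Lemma theta_peigen : 0 < theta peigen.
Proof.
have hh : 0 <= h0 <= h2 by rewrite !ltW.
have [_ _ _ M4] := lint_peigen ler01.
have e1 : - z * 1 + h0 = - h0 by rewrite /z; ring.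
have -> : theta peigen = z^-1 * (z^-1 * uwave h0).
  rewrite /theta (@eq_lint _ _ (fun x => z^-1 * peigen false false x + 0 * 0))//.
    rewrite lint_lin ?ler01 ?lexx//; [|exact: bfam_peigen|exact: bmeas_cst].
    by rewrite M4 e1 uwave_left; ring.
  move=> x /andP[x0 x1]; have [_ -> _ _] := lint_peigen x0.
  by rewrite mul0r addr0.
do 2 (apply: mulr_gt0; first by rewrite invr_gt0).
have -> : uwave h0 = 2 * (t ^+ 3 * sh (s * h0) * cos (t * h0)) +
   2 * (s ^+ 3 * ch (s * h0) * sin (t * h0)).
  by rewrite /uwave /wave /al /be; ring.
have t0 := t_gt0; apply: ltr_pwDl.
  apply: mulr_gt0 => //; apply: mulr_gt0; last exact: cos_th_gt0.
  by apply: mulr_gt0; rewrite ?exprn_gt0 ?sh_gt0 ?mulr_gt0.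
apply: mulr_ge0 => //; apply: mulr_ge0; last exact: sin_th_ge0.
by apply: mulr_ge0; rewrite ?exprn_ge0 ?(ltW s_gt0) ?(ltW (ch_gt0 _)).
Qed.

End Wave.

(** * The equation of the theorem in real form *)

Section Equation.
Context {R : realType}.
Local Open Scope complex_scope.
Local Notation s := (@sigma R).
Local Notation t := (@tau R).

Lemma sqrt5_gt1 : 1 < Num.sqrt 5 :> R.
Proof. by rewrite -[ltLHS]sqrtr1 ltr_sqrt// ltr1n. Qed.

Lemma sigma2E : s ^+ 2 = (-1 + Num.sqrt 5) / 2.
Proof. by rewrite sqr_sqrtr// divr_ge0//; have := sqrt5_gt1; lra. Qed.

Lemma tau2E : t ^+ 2 = (1 + Num.sqrt 5) / 2.
Proof. by rewrite sqr_sqrtr// divr_ge0//; have := sqrt5_gt1; lra. Qed.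

Lemma sigma_gt0 : 0 < s.
Proof. by rewrite sqrtr_gt0 divr_gt0//; have := sqrt5_gt1; lra. Qed.

Lemma sigma_tau : s * t = 1.
Proof.
rewrite -sqrtrM; last by rewrite divr_ge0//; have := sqrt5_gt1; lra.
rewrite (_ : _ * _ = 1) ?sqrtr1//.
have -> : (-1 + Num.sqrt 5) / 2 * ((1 + Num.sqrt 5) / 2) = (Num.sqrt 5 ^+ 2 - 1) / 4 :> R.
  by field.
by rewrite sqr_sqrtr//; field.
Qed.

Lemma tau2_sigma2 : t ^+ 2 = s ^+ 2 + 1.
Proof. by rewrite sigma2E tau2E; field. Qed.

Lemma sqrt5E : Num.sqrt 5 = s ^+ 2 + t ^+ 2 :> R.
Proof. by rewrite sigma2E tau2E; field. Qed.

Lemma cexp_div (a b l : R) : cexp ((a%:C + b%:C * 'i%C) / l%:C) =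
  (expR (a / l) * cos (b / l)) +i* (expR (a / l) * sin (b / l)).
Proof.
have -> : (a%:C + b%:C * 'i%C) / l%:C = (a / l) +i* (b / l).
  have -> : a%:C + b%:C * 'i%C = a +i* b by simpc.
  by rewrite -fmorphV /=; simpc.
by rewrite /cexp /=; simpc.
Qed.

(** The four exponential terms form two conjugate pairs, so the equation is real; the double-angle
    formulas in s h and t h turn it into a product. *)
Lemma eigen_equationE (h : R) : h != 0 ->
  eigen_equation (2 * h)^-1 <-> Dplus s t h * Dminus s t h = 0.
Proof.
move=> h_neq0; set l := (2 * h)^-1.
have lE (a : R) : a / l = (a * h) *+ 2 by rewrite /l invrK mulr2n; ring.
have cE (a b : R) : a%:C - b%:C * 'i%C = a%:C + (- b)%:C * 'i%C.
  by rewrite rmorphN mulNr.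
have cE' (a b : R) : - a%:C + b%:C * 'i%C = (- a)%:C + b%:C * 'i%C by rewrite rmorphN.
have cE'' (a b : R) : - a%:C - b%:C * 'i%C = (- a)%:C + (- b)%:C * 'i%C.
  by rewrite !rmorphN mulNr.
have key : eigen_equation l <->
  - 8 = 4 * (3 * ch (s * h *+ 2) * cos (t * h *+ 2)
     + Num.sqrt 5 * t * (sh (s * h *+ 2) * cos (t * h *+ 2))
     - sh (s * h *+ 2) * sin (t * h *+ 2)
     - Num.sqrt 5 * s * (ch (s * h *+ 2) * sin (t * h *+ 2))) :> R.
  rewrite /eigen_equation /= !cE !cE'' !cE' !cexp_div.
  rewrite -!(rmorph_nat (real_complex R)) /= !lE !mulNr !mulNrn !cosN !sinN.
  rewrite !(@expR_ch R) !chN !shN.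
  move: (Num.sqrt 5) (ch _) (sh _) (cos _) (sin _) => r C S c n.
  simpc.
  by split=> [[-> _]|H]; [ring|rewrite H; congr (_ +i* _); ring].
rewrite key; set X := ch (s * h); set Y := sh (s * h).
set x := cos (t * h); set y := sin (t * h).
have XY : X ^+ 2 - Y ^+ 2 = 1 by exact: ch2Bsh2.
have xy : x ^+ 2 + y ^+ 2 = 1 by exact: cos2Dsin2.
have r2 : (Num.sqrt 5 : R) ^+ 2 = 5 by rewrite sqr_sqrtr.
have ts : t ^+ 2 - s ^+ 2 = 1 by rewrite tau2_sigma2; ring.
rewrite !chM2 !shM2 !mulr2n !cosD !sinD -/X -/Y -/x -/y.
rewrite /Dplus /Dminus -/X -/Y -/x -/y -sqrt5E.
set r := Num.sqrt 5 in r2 *.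
have -> : (r * (X * x - Y * y) - (t + s) * (X * y) + (t - s) * (Y * x)) *
  (r * (X * x + Y * y) + (t - s) * (X * y) + (t + s) * (Y * x)) =
  r ^+ 2 * (X ^+ 2 * x ^+ 2 - Y ^+ 2 * y ^+ 2)
  + r * (2 * t * (X * Y * (x ^+ 2 - y ^+ 2)) - 2 * s * (x * y * (X ^+ 2 + Y ^+ 2)))
  + (t ^+ 2 - s ^+ 2) * (Y ^+ 2 * x ^+ 2 - X ^+ 2 * y ^+ 2)
  - (s * t) * (4 * (X * Y * (x * y))) by ring.
rewrite r2 ts sigma_tau.
have -> : - 8 = - 8 * ((X ^+ 2 - Y ^+ 2) * (x ^+ 2 + y ^+ 2)) by rewrite XY xy; ring.
by split=> H; [move: H; lra|lra].
Qed.

Lemma perron_eigenfamily :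
  exists (lam : R) (phi : bool -> bool -> R -> R),
    [/\ is_largest_positive_root lam, bfam phi,
        lefam zfam phi &
        (forall p q x, 0 <= x <= 1 -> Kop phi p q x = lam * phi p q x) /\
        0 < theta phi].
Proof.
have s0 := sigma_gt0; have t0 := t_gt0 s0 sigma_tau.
pose h2 := atan (t ^+ 3) / t.
have th2 : t * h2 = atan (t ^+ 3) by rewrite /h2 mulrC divfK// gt_eqF.
have h2_gt0 : 0 < h2.
  by rewrite /h2 divr_gt0// -atan0 lt_atan// exprn_gt0.
have th2_lt : t * h2 < pi / 2 by rewrite th2 atan_ltpi2.
have tan_h2 : sin (t * h2) = t ^+ 3 * cos (t * h2).
  rewrite th2 -[X in X * _](atanK (t ^+ 3)) /tan divfK// gt_eqF//.
  by apply: cos_gt0_pihalf; rewrite atan_gtNpi2 atan_ltpi2.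
have [h0 /andP[h00 h02] D0] :=
  Dplus_root s0 sigma_tau tau2_sigma2 h2_gt0 th2_lt tan_h2.
exists (2 * h0)^-1, (peigen s t h0); split.
- split; first by rewrite invr_gt0 mulr_gt0.
    by apply/eigen_equationE; rewrite ?gt_eqF// D0 mul0r.
  (* A larger root l would correspond to some h < h0, where neither factor vanishes. *)
  move=> l l0 El; rewrite leNgt; apply/negP => ltl.
  pose h := (2 * l)^-1.
  have h_gt0 : 0 < h by rewrite invr_gt0 mulr_gt0.
  have lE : l = (2 * h)^-1 by rewrite /h; field; rewrite gt_eqF.
  have hh0 : h < h0.
    rewrite /h; move: ltl; rewrite !invfM => ltl.
    rewrite -(ltr_pM2l (x := 2))// mulrA divff// mul1r.
    by rewrite -[ltRHS]invrK ltf_pV2 ?posrE ?invr_gt0 ?mulr_gt0// invfM.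
  have := El; rewrite lE eigen_equationE ?gt_eqF// => /eqP; apply/negP.
  rewrite gt_eqF// mulr_gt0//.
    exact: (Dplus_gt0 s0 sigma_tau tau2_sigma2 th2_lt D0 (ltW h_gt0) hh0 (ltW h02)).
  apply: Dminus_gt0 => //; first exact: sigma_tau.
    exact: tau2_sigma2.
  by apply: le_trans (ltW th2_lt); rewrite ler_pM2l// (le_trans (ltW hh0)) ?ltW.
- exact: bfam_peigen.
- exact: (peigen_ge0 s0 sigma_tau tau2_sigma2 h2_gt0 th2_lt tan_h2 h00 h02 D0).
- split; last exact: (theta_peigen s0 sigma_tau tau2_sigma2 th2_lt h00 h02 D0).
  by move=> p q x; apply: (Kop_peigen s0 sigma_tau tau2_sigma2 h00 D0).
Qed.

End Equation.

(** * Counting permutations by their last value *)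

Section Words.
Local Open Scope nat_scope.
Implicit Types (r : seq nat) (p q : bool) (x y j : nat).

(** Since words are read from the last value to the first, y < x is an ascent: this is the number of
    steps in the final increasing run. *)
Fixpoint urun r : nat :=
  if r is x :: r' then
    if r' is y :: _ then (if y < x then (urun r').+1 else 0) else 0
  else 0.

Fixpoint drun r : nat :=
  if r is x :: r' then
    if r' is y :: _ then (if x < y then (drun r').+1 else 0) else 0
  else 0.

Fixpoint no_long_run r : bool :=
  if r is _ :: r' then [&& no_long_run r', urun r < 3 & drun r < 3] else true.

(* [r] lists the values of a permutation from the last one to the first one;
   the four values of [(p, q)] say that it does not end with an ascent, with
   two ascents, with two descents, with a descent. *)
Definition admissible p q r : bool :=
  no_long_run r && (if p then urun r <= ~~ q else drun r <= q).

Lemma run_cons x y r : x != y ->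
  (urun (x :: y :: r) = if y < x then (urun (y :: r)).+1 else 0) *
  (drun (x :: y :: r) = if y < x then 0 else (drun (y :: r)).+1).
Proof.
move=> xy; split=> //.
by rewrite [LHS]/drun -/drun ltn_neqAle xy leqNgt; case: ltnP.
Qed.

Lemma no_long_run_cons x r :
  no_long_run (x :: r) = [&& no_long_run r, urun (x :: r) < 3 & drun (x :: r) < 3].
Proof. by []. Qed.

(** The pair (p, q) stands for the signs of the next two steps. Seen from y, the next two signs are
    that of the step from y to x, and p; the case where q completes three equal signs is excluded.
    This is the recursion of [Kop]. *)
Lemma admissible_cons p q x y r : x != y ->
  admissible p q (x :: y :: r) =
  if y < x then ~~ (p && q) && admissible true p (y :: r)
  else ~~ (~~ p && ~~ q) && admissible false p (y :: r).
Proof.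
move=> xy; rewrite /admissible no_long_run_cons !run_cons//.
move: (no_long_run _) (urun _) (drun _) => [] u d; case: (ltnP y x) => _; case: p; case: q => //=;
by case: u => [|[|[|?]]]; case: d => [|[|[|?]]].
Qed.

(** The last step is an ascent or a descent: type [true true] excludes the former, type
    [false false] the latter. *)
Lemma no_long_run_admissible x y r : x != y ->
  no_long_run (x :: y :: r) =
  admissible true true (x :: y :: r) + admissible false false (x :: y :: r) :> nat.
Proof.
move=> xy; rewrite /admissible !run_cons//.
by case: (ltnP y x) => _; case: (no_long_run _).
Qed.

Lemma run_map (f : nat -> nat) r : {mono f : x y / x < y} ->
  (urun (map f r) = urun r) * (drun (map f r) = drun r).
Proof.
move=> mf; elim: r => [//|x [//|y r] [IH1 IH2]].
by rewrite /= in IH1 IH2 *; rewrite !mf IH1 IH2.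
Qed.

Lemma no_long_run_map (f : nat -> nat) r : {mono f : x y / x < y} ->
  no_long_run (map f r) = no_long_run r.
Proof.
move=> mf; elim: r => [//|x r IH].
have [H1 H2] := run_map (x :: r) mf.
by rewrite map_cons /= IH; congr [&& _, _ < _ & _ < _].
Qed.

Lemma admissible_map (f : nat -> nat) p q r : {mono f : x y / x < y} ->
  admissible p q (map f r) = admissible p q r.
Proof. by move=> mf; rewrite /admissible no_long_run_map// !run_map. Qed.

Lemma ltn_bump j : {mono bump j : x y / x < y}.
Proof. by move=> x y; rewrite !ltnNge leq_bump2. Qed.

Definition revals (n : nat) (s : 'S_n) : seq nat :=
  rev [seq val (s i) | i <- enum 'I_n].

Lemma uniq_revals n (s : 'S_n) : uniq (revals s).
Proof.
rewrite rev_uniq map_inj_uniq ?enum_uniq//.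
by move=> i j /val_inj /perm_inj.
Qed.

Lemma size_revals n (s : 'S_n) : size (revals s) = n.
Proof. by rewrite size_rev size_map size_enum_ord. Qed.

Lemma nth_revals n (s : 'S_n) (i : 'I_n) : nth 0 (revals s) (n - i.+1) = s i.
Proof.
have ni : n - i.+1 < n by rewrite ltn_subrL (leq_trans _ (ltn_ord i)).
rewrite nth_rev size_map size_enum_ord//.
have -> : n - (n - i.+1).+1 = i by have := ltn_ord i; lia.
by rewrite (nth_map i) ?size_enum_ord// nth_ord_enum.
Qed.

Lemma revals_lift n (j : 'I_n.+1) (s : 'S_n) :
  revals (lift_perm ord_max j s) = val j :: map (bump j) (revals s).
Proof.
rewrite /revals enum_ordSr map_rcons rev_rcons lift_perm_id map_rev -!map_comp.
congr (_ :: rev _); apply: eq_map => i /=.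
have -> : widen_ord (leqnSn n) i = lift ord_max i by apply/val_inj; rewrite /= /bump leqNgt ltn_ord.
by rewrite lift_perm_lift.
Qed.

Lemma revals_last n (s : 'S_n.+1) :
  revals s = val (s ord_max) :: behead (revals s).
Proof. by rewrite /revals enum_ordSr map_rcons rev_rcons. Qed.

(** Erasing the last value j and standardising the others is a bijection, with inverse
    [lift_perm ord_max j]. *)
Lemma sum_lift_perm n (j : 'I_n.+1) (F : 'S_n.+1 -> nat) :
  \sum_(s : 'S_n.+1 | s ord_max == j) F s = \sum_(s : 'S_n) F (lift_perm ord_max j s).
Proof.
rewrite (reindex (lift_perm ord_max j)) /=; last first.
  pose d (s : 'S_n.+1) (k : 'I_n) := odflt k (unlift (s ord_max) (s (lift ord_max k))).
  have dE (s : 'S_n.+1) k : lift (s ord_max) (d s k) = s (lift ord_max k).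
    rewrite /d; case: unliftP => [k' ->//|/perm_inj/eqP].
    by rewrite eq_sym (negPf (neq_lift _ _)).
  have d_inj (s : 'S_n.+1) : injective (d s).
    move=> k k' /(congr1 (lift (s ord_max))); rewrite !dE => /perm_inj.
    exact: lift_inj.
  exists (fun s => perm (@d_inj s)) => s.
    move=> _; apply/permP => k; rewrite permE; apply: (@lift_inj _ j).
    have := dE (lift_perm ord_max j s) k.
    by rewrite lift_perm_id lift_perm_lift.
  rewrite inE => /eqP sj; apply/permP => k.
  case: (unliftP ord_max k) => [k' ->|->]; last by rewrite lift_perm_id.
  by rewrite lift_perm_lift permE -dE sj.
by apply: eq_bigl => s; rewrite lift_perm_id eqxx.
Qed.

Definition count_last m p q j : nat :=
  \sum_(s : 'S_m.+1 | s ord_max == j :> nat) admissible p q (revals s).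

Lemma sum_count_last m p q (P : pred nat) :
  \sum_(i < m.+1 | P i) count_last m p q i =
  \sum_(s : 'S_m.+1 | P (s ord_max)) admissible p q (revals s).
Proof.
rewrite (partition_big (fun s : 'S_m.+1 => s ord_max) (fun i : 'I_m.+1 => P i))//=.
apply: eq_bigr => i Pi; apply: eq_bigl => s.
by apply/eqP/andP => [/val_inj ->|[_ /eqP ->]//]; split.
Qed.

(** This is [Kop] with sums in place of integrals. The previous value is below the last one exactly
    when its rank among the remaining values is less than j, hence i < j against j <= i. *)
Lemma count_lastS m p q j : j < m.+2 ->
  count_last m.+1 p q j =
  (if p && q then 0 else \sum_(i < m.+1 | i < j) count_last m true p i) +
  (if ~~ p && ~~ q then 0 else \sum_(i < m.+1 | j <= i) count_last m false p i).
Proof.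
move=> jm; rewrite (sum_count_last _ _ _ (fun i => i < j)).
rewrite (sum_count_last _ _ _ (fun i => j <= i)) /count_last.
rewrite (sum_lift_perm (Ordinal jm) (fun s => admissible p q (revals s))).
have step (s : 'S_m.+1) : admissible p q (revals (lift_perm ord_max (Ordinal jm) s)) =
   (if s ord_max < j then ~~ (p && q) && admissible true p (revals s)
    else ~~ (~~ p && ~~ q) && admissible false p (revals s)).
  have := uniq_revals (lift_perm ord_max (Ordinal jm) s).
  rewrite revals_lift [revals s]revals_last map_cons /= inE negb_or.
  case/andP=> /andP[ne _] _; rewrite admissible_cons//.
  rewrite -map_cons !admissible_map; try exact: ltn_bump.
  rewrite /= /bump; case: (leqP j (s ord_max)) => sj.
    by rewrite add1n ltnNge ltnW.
  by rewrite add0n sj.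
rewrite (eq_bigr _ (fun s _ => congr1 nat_of_bool (step s))).
rewrite (bigID (fun s : 'S_m.+1 => s ord_max < j)) /=; congr (_ + _).
  under eq_bigr => s sj do rewrite sj.
  by case: (p && q) => //=; rewrite big1.
rewrite (eq_bigl (fun s : 'S_m.+1 => j <= s ord_max)); last first.
  by move=> s; rewrite -leqNgt.
under eq_bigr => s sj do rewrite ltnNge sj /=.
by case: (~~ p && ~~ q) => //=; rewrite big1.
Qed.

Lemma count_last0 p q : count_last 0 p q 0 = 1.
Proof.
rewrite /count_last (big_pred1 1%g) => [|s].
  by rewrite /revals enum_ordSl /= enum_ord0 /= /admissible; case: p.
rewrite ord1 eqxx; apply/esym/eqP/permP => i.
by rewrite !ord1.
Qed.

Lemma no_long_runPn r : reflect (exists k, k.+3 < size r /\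
   ([/\ nth 0 r k.+3 < nth 0 r k.+2, nth 0 r k.+2 < nth 0 r k.+1 &
        nth 0 r k.+1 < nth 0 r k] \/
    [/\ nth 0 r k.+3 > nth 0 r k.+2, nth 0 r k.+2 > nth 0 r k.+1 &
        nth 0 r k.+1 > nth 0 r k])) (~~ no_long_run r).
Proof.
have u3 r' : 2 < urun r' -> 3 < size r' /\
    [/\ nth 0 r' 3 < nth 0 r' 2, nth 0 r' 2 < nth 0 r' 1 & nth 0 r' 1 < nth 0 r' 0].
  case: r' => [|x [|y [|z [|w l]]]] //=.
  - by case: ifP.
  - by case: ifP => // _; case: ifP.
  by case: (ltnP y x) => //; case: (ltnP z y) => //; case: (ltnP w z).
have d3 r' : 2 < drun r' -> 3 < size r' /\
    [/\ nth 0 r' 3 > nth 0 r' 2, nth 0 r' 2 > nth 0 r' 1 & nth 0 r' 1 > nth 0 r' 0].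
  case: r' => [|x [|y [|z [|w l]]]] //=.
  - by case: ifP.
  - by case: ifP => // _; case: ifP.
  by case: (ltnP x y) => //; case: (ltnP y z) => //; case: (ltnP z w).
elim: r => [|x r IH]; first by constructor => -[k []].
rewrite no_long_run_cons !negb_and -!leqNgt; apply: (iffP or3P).
  case=> [/IH[k [kr H]]|/u3[sz H]|/d3[sz H]].
  - by exists k.+1.
  - by exists 0; split=> //; left.
  - by exists 0; split=> //; right.
case=> -[|k] [kr H]; last by constructor 1; apply/IH; exists k.
case: r {IH} kr H => [|y [|z [|w l]]] //= _ [[-> -> ->]|[-> -> ->]].
  by constructor 2.
by constructor 3.
Qed.

Lemma alphaE n : alpha n = \sum_(s : 'S_n) no_long_run (revals s).
Proof.
rewrite /alpha -sum1_card big_mkcond /=; apply: eq_bigr => s _.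
rewrite inE; case: asboolP => [[na nd]|H]; apply/esym; last first.
  apply/eqP; rewrite eqb0; apply/negP => gs; apply: H; split.
    move=> [i1 [i2 [i3 [i4 [[e2 e3 e4] [h1 h2 h3]]]]]].
    move: gs; apply/negP/no_long_runPn; exists (n - i4.+1).
    have := ltn_ord i4; rewrite size_revals => i4n.
    split; first by lia.
    left; rewrite (_ : (n - i4.+1).+3 = n - i1.+1); last by lia.
    rewrite (_ : (n - i4.+1).+2 = n - i2.+1); last by lia.
    rewrite (_ : (n - i4.+1).+1 = n - i3.+1); last by lia.
    by rewrite !nth_revals.
  move=> [i1 [i2 [i3 [i4 [[e2 e3 e4] [h1 h2 h3]]]]]].
  move: gs; apply/negP/no_long_runPn; exists (n - i4.+1).
  have := ltn_ord i4; rewrite size_revals => i4n.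
  split; first by lia.
  right; rewrite (_ : (n - i4.+1).+3 = n - i1.+1); last by lia.
  rewrite (_ : (n - i4.+1).+2 = n - i2.+1); last by lia.
  rewrite (_ : (n - i4.+1).+1 = n - i3.+1); last by lia.
  by rewrite !nth_revals.
apply/eqP; rewrite eqb1; apply/negPn/negP => /no_long_runPn[k []].
rewrite size_revals => kn H.
have l1 : n - k.+4 < n by lia.
have l2 : n - k.+3 < n by lia.
have l3 : n - k.+2 < n by lia.
have l4 : n - k.+1 < n by lia.
have e1 : nth 0 (revals s) k.+3 = s (Ordinal l1).
  by rewrite -nth_revals /=; congr nth; lia.
have e2 : nth 0 (revals s) k.+2 = s (Ordinal l2).
  by rewrite -nth_revals /=; congr nth; lia.
have e3 : nth 0 (revals s) k.+1 = s (Ordinal l3).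
  by rewrite -nth_revals /=; congr nth; lia.
have e4 : nth 0 (revals s) k = s (Ordinal l4).
  by rewrite -nth_revals /=; congr nth; lia.
rewrite e1 e2 e3 e4 in H; case: H => -[h1 h2 h3].
  apply: na; exists (Ordinal l1), (Ordinal l2), (Ordinal l3), (Ordinal l4).
  by split; split=> //=; lia.
apply: nd; exists (Ordinal l1), (Ordinal l2), (Ordinal l3), (Ordinal l4).
by split; split=> //=; lia.
Qed.

(** When the last of m + 3 values is the largest or the smallest, one sum of [count_lastS] is empty
    and the other runs over all permutations of m + 2 values; the two counts are those of
    [no_long_run_admissible]. *)
Lemma alpha_count_last m : alpha m.+2 =
  count_last m.+2 true false m.+2 + count_last m.+2 false true 0.
Proof.
rewrite alphaE !count_lastS//=.
rewrite [X in _ = _ + X + _]big_pred0 => [|i]; last by rewrite leqNgt ltn_ord.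
rewrite [X in _ = _ + (X + _)]big_pred0 // addn0 add0n.
rewrite (sum_count_last _ _ _ (fun i => i < m.+2)).
rewrite (sum_count_last _ _ _ (fun i => 0 <= i)).
rewrite [X in _ = X + _](eq_bigl xpredT) => [|s]; last by rewrite ltn_ord.
rewrite -big_split /=; apply: eq_bigr => s _.
have := uniq_revals s; have := size_revals s.
case: (revals s) => [|x [|y r]] //= _; rewrite inE negb_or.
by case/andP=> /andP[xy _] _; rewrite no_long_run_admissible.
Qed.

End Words.

(** * From counts to iterated integrals *)

Section Bernstein.
Context {R : realType}.

(* A permutation of [m + 1] points of [0, 1] with last rank [j] contributes
   the density of its last point. *)
Definition bern (m : nat) (N : nat -> R) : {poly R} :=
  \sum_(j < m.+1) (N j / (j`! * (m - j)`!)%:R) *: ('X^j * (1 - 'X) ^+ (m - j)).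

Lemma bern_horner0 m N : (bern m N).[0] = N 0%N / m`!%:R.
Proof.
rewrite /bern horner_sum big_ord_recl big1 => [|i _].
  rewrite /= [LHS]addr0 hornerZ hornerM !horner_exp !hornerE subr0 expr1n.
  by rewrite /= expr0 subn0 [LHS]mulr1 [LHS]mulr1.
by rewrite hornerZ hornerM horner_exp hornerX expr0n /= mul0r mulr0.
Qed.

Lemma bern_horner1 m N : (bern m N).[1] = N m / m`!%:R.
Proof.
rewrite /bern horner_sum big_ord_recr big1 => [|i _].
  rewrite /= [LHS]add0r hornerZ hornerM !horner_exp !hornerE subrr expr1n.
  by rewrite /= subnn expr0 [LHS]mulr1 [LHS]mulr1 muln1.
rewrite hornerZ hornerM !horner_exp !hornerE subrr expr0n.
by rewrite /= subn_eq0 leqNgt (ltn_ord i) [LHS]mulr0.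
Qed.

(** Differentiation acts as the forward difference on the coefficients, so primitives are partial
    sums: this carries [count_lastS] to [Kop]. *)
Lemma deriv_bern m N : (bern m.+1 N)^`() = bern m (fun j => N j.+1 - N j).
Proof.
(* On divided powers the derivative only shifts the index, up to sign. *)
pose U j : {poly R} := j`!%:R^-1 *: 'X^j.
pose V k : {poly R} := k`!%:R^-1 *: (1 - 'X) ^+ k.
have BE m' N' : bern m' N' = \sum_(j < m'.+1) N' j *: (U j * V (m' - j)%N).
  apply: eq_bigr => j _; rewrite /U /V -scalerAl -scalerAr !scalerA.
  by rewrite natrM invfM mulrA.
have fS (i : nat) : i.+1`!%:R^-1 * i.+1%:R = i`!%:R^-1 :> R.
  have i1 : i.+1%:R != 0 :> R by rewrite pnatr_eq0.
  by rewrite factS natrM invfM mulrAC mulVf// mul1r.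
have dU j : (U j)^`() = if j is j'.+1 then U j' else 0.
  rewrite /U derivZ derivXn; case: j => [|j]; first by rewrite mulr0n scaler0.
  by rewrite -scalerMnr scalerMnl -mulr_natr fS.
have dV k : (V k)^`() = if k is k'.+1 then - V k' else 0.
  rewrite /V derivZ deriv_exp derivB derivX derivC sub0r.
  case: k => [|k]; first by rewrite mulr0n scaler0.
  by rewrite -scalerMnr scalerMnl -mulr_natr fS mulN1r scalerN.
rewrite !BE raddf_sum /=.
under eq_bigr => j _ do rewrite derivZ derivM scalerDr.
rewrite big_split /= big_ord_recl /= dU mul0r scaler0 add0r.
rewrite [X in _ + X]big_ord_recr /= subnn dV mulr0 scaler0 addr0 -big_split /=.
apply: eq_bigr => j _; rewrite /bump leq0n add1n subSS dU.
have -> : (m.+1 - j = (m - j).+1)%N by rewrite subSn// -ltnS.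
by rewrite dV mulrN scalerN scalerBl.
Qed.

Lemma is_derive_bern m N (x : R) :
  is_derive x (1 : R) (fun t => (bern m.+1 N).[t])
    (bern m (fun j => N j.+1 - N j)).[x].
Proof. by rewrite -deriv_bern; exact: is_derive_poly. Qed.

Lemma eq_bern m N N' : (forall j, (j <= m)%N -> N j = N' j) -> bern m N = bern m N'.
Proof. by move=> NN'; apply: eq_bigr => j _; rewrite NN'// -ltnS. Qed.

Lemma continuous_bern m N : continuous (fun t => (bern m N).[t]).
Proof. exact: continuous_horner. Qed.

Lemma lint_bern m N S (x : R) : 0 <= x -> S 0%N = 0 ->
  (forall j, (j <= m)%N -> S j.+1 = S j + N j) ->
  lint (fun t => (bern m N).[t]) x = (bern m.+1 S).[x].
Proof.
move=> x0 S0 SS; have -> : bern m N = bern m (fun j => S j.+1 - S j).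
  by apply: eq_bern => j jm; rewrite SS// addrAC subrr add0r.
rewrite (lint_derive x0 (@continuous_bern _ _) (is_derive_bern m S)).
by rewrite bern_horner0 S0 mul0r subr0.
Qed.

Lemma rint_bern m N S (x : R) : 0 <= x -> S m.+1 = 0 ->
  (forall j, (j <= m)%N -> S j = S j.+1 + N j) ->
  rint (fun t => (bern m N).[t]) x = (bern m.+1 S).[x].
Proof.
move=> x0 S0 SS; pose T j := - S j.
have -> : bern m N = bern m (fun j => T j.+1 - T j).
  by apply: eq_bern => j jm; rewrite /T (SS _ jm); ring.
rewrite /rint (lint_derive x0 (@continuous_bern _ _) (is_derive_bern m T)).
rewrite (lint_derive ler01 (@continuous_bern _ _) (is_derive_bern m T)).
have -> : (bern m.+1 T).[x] = - (bern m.+1 S).[x].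
  rewrite -hornerN /bern -sumrN; congr (_.[x]); apply: eq_bigr => j _.
  by rewrite -scaleNr mulNr.
by rewrite bern_horner1 {1}/T S0; ring.
Qed.

Lemma bmeas_bern m N : bmeas (fun t => (bern m N).[t]).
Proof. by apply: continuous_bmeas; exact: continuous_bern. Qed.

Definition count_fam (m : nat) : bool -> bool -> R -> R := fun p q x =>
  (bern m (fun j => (count_last m p q j)%:R)).[x].

Lemma Kop_count_fam m p q x : 0 <= x -> Kop (count_fam m) p q x = count_fam m.+1 p q x.
Proof.
move=> x0; pose L j : R := \sum_(i < m.+1 | (i < j)%N) (count_last m true p i)%:R.
pose G j : R := \sum_(i < m.+1 | (j <= i)%N) (count_last m false p i)%:R.
have L0 : L 0%N = 0 by rewrite /L big_pred0.
have LS j : (j <= m)%N -> L j.+1 = L j + (count_last m true p j)%:R.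
  move=> jm; rewrite /L (bigD1 (Ordinal (jm : (j < m.+1)%N)))//= addrC; congr (_ + _).
  by apply: eq_bigl => i; rewrite ltnS ltn_neqAle andbC -val_eqE.
have G0 : G m.+1 = 0.
  by rewrite /G big_pred0// => i; rewrite leqNgt ltn_ord.
have GS j : (j <= m)%N -> G j = G j.+1 + (count_last m false p j)%:R.
  move=> jm; rewrite /G (bigD1 (Ordinal (jm : (j < m.+1)%N)))//= addrC; congr (_ + _).
  by apply: eq_bigl => i; rewrite ltn_neqAle andbC eq_sym -val_eqE.
have cE j : (j <= m.+1)%N -> (count_last m.+1 p q j)%:R =
    (if p && q then 0 else L j) + (if ~~ p && ~~ q then 0 else G j).
  move=> jm; rewrite count_lastS// natrD; congr (_ + _).
    by case: (p && q) => //; rewrite natr_sum.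
  by case: (~~ p && ~~ q) => //; rewrite natr_sum.
rewrite /count_fam (eq_bern cE) /Kop /count_fam (lint_bern x0 L0 LS) (rint_bern x0 G0 GS).
have bD N N' : bern m.+1 (fun j => N j + N' j) = bern m.+1 N + bern m.+1 N'.
  by rewrite /bern -big_split /=; apply: eq_bigr => j _; rewrite mulrDl scalerDl.
rewrite bD hornerD; congr (_ + _); case: ifP => // _;
  by rewrite /bern horner_sum big1// => j _; rewrite mul0r scale0r horner0.
Qed.

Lemma count_fam0 p q x : count_fam 0 p q x = 1.
Proof.
rewrite /count_fam /bern big_ord1 count_last0 fact0 divr1 expr0 mulr1 scale1r.
by rewrite /= hornerE.
Qed.

Lemma bfam_count_fam m : bfam (count_fam m).
Proof. by move=> p q; exact: bmeas_bern. Qed.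

Lemma iterKop_count_fam m p q x : 0 <= x <= 1 ->
  iter m Kop (count_fam 0) p q x = count_fam m p q x.
Proof.
elim: m p q x => [//|m IH] p q x x01; rewrite iterS -Kop_count_fam; last by case/andP: x01.
exact: eq_Kop.
Qed.

(** At 1 and at 0 the density polynomials keep only their last and first coefficients, the two
    counts of [alpha_count_last]. *)
Lemma alpha_iterKop m : (alpha m.+2)%:R / (m.+2)`!%:R =
  iter m.+2 Kop (count_fam 0) true false 1 + iter m.+2 Kop (count_fam 0) false true 0.
Proof.
rewrite !iterKop_count_fam ?lexx ?ler01//.
by rewrite /count_fam bern_horner1 bern_horner0 alpha_count_last natrD mulrDl.
Qed.

End Bernstein.

(** * The operator on functions of three variables *)

Section Split.
Context {R : realType}.
Notation mu := (@lebesgue_measure R).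

(** The integrand of [op3] has one formula on each side of x and none at x itself; measurability and
    boundedness of g are deduced from those of h1 and h2. *)
Lemma Rintegral_split (g h1 h2 : R -> R) (x : R) : 0 <= x <= 1 ->
  bmeas h1 -> bmeas h2 ->
  (forall t, 0 <= t -> t < x -> g t = h1 t) ->
  (forall t, x < t -> t <= 1 -> g t = h2 t) ->
  \int[mu]_(t in `[0, 1]) g t = lint h1 x + rint h2 x.
Proof.
move=> x01 b1 b2 g1 g2; have /andP[x0 x1] := x01.
have sub1 : `[0, x[ `<=` (`[0, 1] : set R).
  by apply: subset_itv; rewrite bnd_simp.
have sub2 : `]x, 1] `<=` (`[0, 1] : set R).
  by apply: subset_itv; rewrite bnd_simp.
have mg1 : measurable_fun (`[0, x[ : set R) g.
  apply: (eq_measurable_fun h1); last by apply: measurable_funS b1.1.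
  by move=> t; rewrite inE/= in_itv/= => /andP[t0 tx]; rewrite g1.
have mg2 : measurable_fun (`]x, 1] : set R) g.
  apply: (eq_measurable_fun h2); last by apply: measurable_funS b2.1.
  by move=> t; rewrite inE/= in_itv/= => /andP[t0 tx]; rewrite g2.
have mg12 : measurable_fun (`[0, x] : set R) g.
  rewrite (_ : `[0, x] = `[0, x[ `|` [set x])%classic; last first.
    by rewrite setUitv1// bnd_simp.
  by apply/measurable_funU => //; split => //; exact: measurable_fun_set1.
have mg : measurable_fun (`[0, 1] : set R) g.
  rewrite (@itv_bndbnd_setU _ _ (BLeft 0) (BRight x) (BRight 1)) ?bnd_simp//.
  by apply/measurable_funU.
have ig : mu.-integrable `[0, 1] (EFin \o g).
  have [_ [M1 HM1]] := b1; have [_ [M2 HM2]] := b2.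
  apply: measurable_bounded_integrable => //=.
    by rewrite lebesgue_measure_itv/= lte_fin ltr01 oppr0 adde0 ltry.
  exists (`|M1| + `|M2| + `|g x|); split; first exact: num_real.
  move=> N MN t /=; rewrite in_itv/= => /andP[t0 t1]; apply: le_trans (ltW MN).
  have a1 := ler_norm M1; have a2 := ler_norm M2.
  have a3 := normr_ge0 M1; have a4 := normr_ge0 M2; have a5 := normr_ge0 (g x).
  case: (ltgtP t x) => [tx|xt|->].
  - by rewrite g1//; have := HM1 t; rewrite t0 t1 => /(_ isT); lra.
  - by rewrite g2//; have := HM2 t; rewrite t0 t1 => /(_ isT); lra.
  - by lra.
have := @Rintegral_itvB _ g (BLeft 0) (BRight 1) x ig.
rewrite !bnd_simp => /(_ x0 x1) /eqP; rewrite subr_eq => /eqP ->.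
rewrite addrC; congr (_ + _).
  have ig1 : mu.-integrable `[0, x[ (EFin \o g) by apply: integrableS ig.
  have ih1 : mu.-integrable `[0, x[ (EFin \o h1).
    by apply: integrableS (bmeas_integrable b1).
  have E1 := @Rintegral_itv_bndo_bndc R (BLeft 0) x g ig1.
  have E2 := @Rintegral_itv_bndo_bndc R (BLeft 0) x h1 ih1.
  rewrite -[LHS]E1 -[RHS]E2.
  by apply: eq_Rintegral => t; rewrite inE/= in_itv/= => /andP[t0 tx]; rewrite g1.
rewrite /rint lintB//.
by apply: eq_Rintegral => t; rewrite inE/= in_itv/= => /andP[t0 tx]; rewrite g2.
Qed.

End Split.

Section Transfer3.
Context {R : realType}.
Notation mu := (@lebesgue_measure R).
Local Notation R1 := (measurableTypeR R).
Local Notation R3 := (R1 * R1 * R1)%type.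
Local Notation fam := (bool -> bool -> R -> R).
Implicit Types (g G f : R3 -> R) (x : R3).

(** As [chi] is real, [opT] acts separately on real and imaginary parts; this is its action on
    each. *)
Definition op3 g : R3 -> R := fun x =>
  \int[mu]_(t in `[0, 1]) (chi t x.1.1 x.1.2 x.2 * g (t, x.1.1, x.1.2)).

(** Families are controlled on [0, 1] only; the restriction makes the lifted function bounded and
    measurable on the whole space. *)
Definition lift3 (y : fam) : R3 -> R := fun x =>
  (y (x.1.1 < x.1.2) (x.1.2 < x.2) \_ `[0, 1]) x.1.1.

Lemma lift3E (y : fam) x : cube x ->
  lift3 y x = y (x.1.1 < x.1.2) (x.1.2 < x.2) x.1.1.
Proof. by move=> [[/= h _] _]; rewrite /lift3 patchE mem_set. Qed.

Lemma cube_in x : cube x -> [/\ 0 <= x.1.1 <= 1, 0 <= x.1.2 <= 1 & 0 <= x.2 <= 1].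
Proof. by case=> [[/=]]; rewrite !in_itv. Qed.

Lemma in_cube (a b c : R) : 0 <= a <= 1 -> 0 <= b <= 1 -> 0 <= c <= 1 ->
  cube (a, b, c).
Proof. by move=> ha hb hc; split; [split|]; rewrite /= in_itv. Qed.

Lemma op3_lift3 (y : fam) x : bfam y -> cube x ->
  x.1.1 != x.1.2 -> x.1.2 != x.2 -> op3 (lift3 y) x = lift3 (Kop y) x.
Proof.
move=> by_ xc n12 n23; have [x1 x2 x3] := cube_in xc.
rewrite lift3E// /op3; set p := x.1.1 < x.1.2; set q := x.1.2 < x.2.
have np : (x.1.1 > x.1.2) = ~~ p by rewrite /p -leNgt le_eqVlt eq_sym (negPf n12).
have nq : (x.1.2 > x.2) = ~~ q by rewrite /q -leNgt le_eqVlt eq_sym (negPf n23).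
rewrite (@Rintegral_split _ _
  (fun t => if p && q then 0 else y true p t)
  (fun t => if ~~ p && ~~ q then 0 else y false p t) x.1.1 x1).
- rewrite /Kop; congr (_ + _).
    case: (p && q) => //; rewrite lint_cst ?mul0r//; by case/andP: x1.
  case: (~~ p && ~~ q) => //; rewrite /rint !lint_cst ?mul0r ?subrr//.
  by case/andP: x1.
- by case: (p && q) => //; exact: bmeas_cst.
- by case: (~~ p && ~~ q) => //; exact: bmeas_cst.
- move=> t t0 tx; have /andP[_ x11] := x1.
  rewrite lift3E /=; last by apply: in_cube => //; rewrite t0 (le_trans (ltW tx)).
  rewrite /chi tx np nq -/p -/q [x.1.1 < t]ltNge (ltW tx) /= orbF.
  by case: (p && q); rewrite ?mul0r ?mul1r.
- move=> t tx t1; have /andP[x10 _] := x1.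
  rewrite lift3E /=; last by apply: in_cube => //; rewrite t1 (le_trans x10)// ltW.
  rewrite /chi tx np nq -/p -/q [t < x.1.1]ltNge (ltW tx) /=.
  by case: (~~ p && ~~ q); rewrite ?mul0r ?mul1r.
Qed.

Lemma eq_op3 g g' x : (forall t, 0 <= t <= 1 -> g (t, x.1.1, x.1.2) = g' (t, x.1.1, x.1.2)) ->
  op3 g x = op3 g' x.
Proof.
move=> gg; apply: eq_Rintegral => t; rewrite inE/= in_itv/= => t01.
by rewrite gg.
Qed.

Lemma measurable_coord1 : measurable_fun setT (fun x : R3 => x.1.1 : R1).
Proof. exact: (measurableT_comp measurable_fst measurable_fst). Qed.
Lemma measurable_coord2 : measurable_fun setT (fun x : R3 => x.1.2 : R1).
Proof. exact: (measurableT_comp measurable_snd measurable_fst). Qed.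
Lemma measurable_coord3 : measurable_fun setT (fun x : R3 => x.2 : R1).
Proof. exact: measurable_snd. Qed.

Lemma measurable_chi d (T : measurableType d) (a b c e : T -> R) :
  measurable_fun setT a -> measurable_fun setT b ->
  measurable_fun setT c -> measurable_fun setT e ->
  measurable_fun setT (fun z => chi (a z) (b z) (c z) (e z)).
Proof.
move=> ma mb mc me; apply: measurable_fun_ifT => //.
apply: measurable_or; (apply: measurable_and; first exact: measurable_fun_ltr);
  by apply: measurable_and; exact: measurable_fun_ltr.
Qed.

Lemma chi_ge0 (a b c e : R) : 0 <= chi a b c e.
Proof. by rewrite /chi; case: ifP. Qed.

Lemma chi_le1 (a b c e : R) : chi a b c e <= 1.
Proof. by rewrite /chi; case: ifP. Qed.

Lemma chi_rev (a b c e : R) : chi a b c e = chi e c b a.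
Proof.
rewrite /chi.
by move: (a < b) (b < c) (c < e) (b < a) (c < b) (e < c) => [] [] [] [] [] [].
Qed.

Local Notation R4 := (R1 * R3)%type.

Definition ker3 g : R4 -> R := fun z =>
  chi z.1 z.2.1.1 z.2.1.2 z.2.2 * g (z.1, z.2.1.1, z.2.1.2).

Lemma measurable_ker3 g : measurable_fun setT g -> measurable_fun setT (ker3 g).
Proof.
move=> mg.
have n11 : measurable_fun setT (fun z : R4 => z.2.1.1 : R1).
  exact: (measurableT_comp measurable_coord1 measurable_snd).
have n12 : measurable_fun setT (fun z : R4 => z.2.1.2 : R1).
  exact: (measurableT_comp measurable_coord2 measurable_snd).
have n2 : measurable_fun setT (fun z : R4 => z.2.2 : R1).
  exact: (measurableT_comp measurable_coord3 measurable_snd).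
apply: measurable_funM; first exact: measurable_chi.
apply: (measurableT_comp mg); apply: measurable_fun_pair; last exact: n12.
by apply: measurable_fun_pair; [exact: measurable_fst|exact: n11].
Qed.

Lemma op3E g x : op3 g x = \int[mu]_(t in `[0, 1]) ker3 g (t, x).
Proof. by []. Qed.

Lemma measurable_op3 g : measurable_fun setT g -> (forall x, 0 <= g x) ->
  measurable_fun setT (op3 g).
Proof.
move=> mg g0; pose F (z : R4) : \bar R := (\1_(`[0, 1]%classic : set R) z.1 * ker3 g z)%:E.
have mF : measurable_fun setT F.
  apply/measurable_EFinP; apply: measurable_funM; last exact: measurable_ker3.
  by apply: (measurableT_comp _ measurable_fst); exact: measurable_indic.
have F0 z : (0 <= F z)%E by rewrite lee_fin !mulr_ge0// chi_ge0.
have := measurable_fun_fubini_tonelli_G (m1 := mu) F mF F0.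
move=> /(measurableT_comp (fine_measurable measurableT)).
congr measurable_fun; apply/funext => x /=.
rewrite op3E /Rintegral [in RHS]integral_mkcond /fubini_G; congr fine.
apply: eq_integral => t _; rewrite /F patchE indicE.
by case: ifP => _; rewrite ?mul1r ?mul0r.
Qed.

Lemma ker3_bmeas g x M : measurable_fun setT g -> (forall x, `|g x| <= M) ->
  bmeas (fun t => ker3 g (t, x)).
Proof.
move=> mg gM; split.
  apply: measurable_funTS; apply: (measurableT_comp (measurable_ker3 mg)).
  by apply: measurable_fun_pair.
exists M => t _; rewrite normrM ger0_norm ?chi_ge0// -[leRHS]mul1r.
by apply: ler_pM => //; [exact: chi_ge0|exact: chi_le1].
Qed.

Lemma normr_op3_le g x M : measurable_fun setT g -> (forall x, `|g x| <= M) ->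
  `|op3 g x| <= M.
Proof.
move=> mg gM; have b := ker3_bmeas x mg gM.
have M0 : 0 <= M by apply: le_trans (gM x).
have H (c : R) : \int[mu]_(t in `[0, 1]) c = c by rewrite -/(lint (fun=> c) 1) lint_cst// mulr1.
have kM t : `|ker3 g (t, x)| <= M.
  rewrite normrM ger0_norm ?chi_ge0// -[leRHS]mul1r.
  by apply: ler_pM => //; [exact: chi_ge0|exact: chi_le1].
rewrite ler_norml op3E; apply/andP; split.
  rewrite -[leLHS]H; apply: le_Rintegral => //; [exact: bmeas_integrable (bmeas_cst _)|exact: bmeas_integrable|].
  by move=> t _; have := kM t; rewrite ler_norml => /andP[].
rewrite -[leRHS]H; apply: le_Rintegral => //; [exact: bmeas_integrable|exact: bmeas_integrable (bmeas_cst _)|].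
by move=> t _; have := kM t; rewrite ler_norml => /andP[].
Qed.

Lemma op3_ge0 g x : (forall x, 0 <= g x) -> 0 <= op3 g x.
Proof. by move=> g0; apply: Rintegral_ge0 => t _; rewrite mulr_ge0// chi_ge0. Qed.

Lemma eq_chi (a b c e c' e' : R) : (b < c) = (b < c') -> (c < b) = (c' < b) ->
  (c < e) = (c' < e') -> (e < c) = (e' < c') -> chi a b c e = chi a b c' e'.
Proof. by rewrite /chi => -> -> -> ->. Qed.

(* Since [op3 g] depends on its last coordinate through its order with the
   previous one only, [op3 (op3 g)] is a function of the first coordinate and
   of the type. *)
Lemma op3_op3 g : measurable_fun setT g -> (forall x, 0 <= g x <= 1) ->
  exists2 y : fam, bfam y &
    forall x, cube x -> x.1.1 != x.1.2 -> x.1.2 != x.2 ->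
      op3 (op3 g) x = lift3 y x.
Proof.
move=> mg g01; have g0 x : 0 <= g x by case/andP: (g01 x).
have gM x : `|g x| <= 1 by rewrite ger0_norm//; case/andP: (g01 x).
(* A representative point of type (p, q) with first coordinate a. It may leave the cube, since [chi]
   only sees the order of its arguments. *)
pose pt (p q : bool) (a : R) : R3 :=
  let b := if p then a + 1 else a - 1 in (a, b, if q then b + 1 else b - 1).
have mog := measurable_op3 mg g0.
have mogg := measurable_op3 mog (fun x => op3_ge0 x g0).
have mpt p q : measurable_fun setT (pt p q).
  have mA (c : R) : measurable_fun setT (fun a : R1 => a + c : R1) by apply: measurable_funD.
  rewrite /pt; case: p; case: q; apply: measurable_fun_pair;
    try (apply: measurable_fun_pair => //; exact: mA);
    (apply: (measurableT_comp (f := fun b : R1 => b + _) (mA _)); exact: mA).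
exists (fun p q a => op3 (op3 g) (pt p q a)) => [p q|x xc n12 n23].
  split; first by apply: measurable_funTS; exact: measurableT_comp.
  exists 1 => a _; apply: normr_op3_le => // x; exact: normr_op3_le.
rewrite (lift3E _ xc) /pt.
set a := x.1.1 in n12 *; set b' := x.1.2 in n12 n23 *; set c' := x.2 in n23 *.
set b := if a < b' then a + 1 else a - 1.
set c := if b' < c' then b + 1 else b - 1.
have up (o : bool) (e : R) : (e < if o then e + 1 else e - 1) = o.
  by case: o; [apply/idP; lra|apply/negbTE; rewrite -leNgt; lra].
have dn (o : bool) (e : R) : ((if o then e + 1 else e - 1) < e) = ~~ o.
  by case: o => /=; [apply/negbTE; rewrite -leNgt; lra|apply/idP; lra].
have ab : (a < b') = (a < b) by rewrite /b up.
have ba : (b' < a) = (b < a) by rewrite /b dn -leNgt le_eqVlt eq_sym (negPf n12).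
have bc : (b' < c') = (b < c) by rewrite /c up.
have cb : (c' < b') = (c < b) by rewrite /c dn -leNgt le_eqVlt eq_sym (negPf n23).
rewrite !op3E; apply: eq_Rintegral => t _; rewrite /ker3 /= -/a -/b' -/c'.
rewrite (eq_chi _ ab ba bc cb); congr (_ * _).
rewrite !op3E; apply: eq_Rintegral => s _; rewrite /ker3 /=; congr (_ * _).
by rewrite /chi ab ba.
Qed.

End Transfer3.

(** * Integration over three and four coordinates *)

Section ProductSigmaFinite.
Local Open Scope ereal_scope.
Context d1 d2 (T1 : measurableType d1) (T2 : measurableType d2) (R : realType).
Variable m1 : {sigma_finite_measure set T1 -> \bar R}.
Variable m2 : {sigma_finite_measure set T2 -> \bar R}.

(* An alias of [m1 \x m2], which has no canonical sigma-finite structure. *)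
Definition sigma_finite_product : set (T1 * T2) -> \bar R := m1 \x m2.

HB.instance Definition _ := Measure.on sigma_finite_product.

Let sigma_finite_productT : sigma_finite setT sigma_finite_product.
Proof.
have /sigma_finiteP[A [TA ndA Aoo]] := sigma_finiteT m1.
have /sigma_finiteP[B [TB ndB Boo]] := sigma_finiteT m2.
exists (fun n => A n `*` B n).
  apply/seteqP; split=> [[x y] _|//].
  have [i _ Aix] : (\bigcup_n A n) x by rewrite -TA.
  have [j _ Bjy] : (\bigcup_n B n) y by rewrite -TB.
  exists (maxn i j) => //; split => /=.
    by move: x Aix; apply/subsetPset/ndA; exact: leq_maxl.
  by move: y Bjy; apply/subsetPset/ndB; exact: leq_maxr.
move=> n; have [mA Afin] := Aoo n; have [mB Bfin] := Boo n.
split; first exact: measurableX.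
rewrite /sigma_finite_product product_measure1E//.
by rewrite lte_mul_pinfty// ge0_fin_numE.
Qed.

HB.instance Definition _ := Measure_isSigmaFinite.Build _ _ _
  sigma_finite_product sigma_finite_productT.

End ProductSigmaFinite.

Section ProductIntegrals.
Context {R : realType}.
Notation mu := (@lebesgue_measure R).
Local Notation R1 := (measurableTypeR R).
Local Notation R3 := (R1 * R1 * R1)%type.
Local Notation R4 := (R1 * R3)%type.
Local Notation fam := (bool -> bool -> R -> R).
Implicit Types (g G f : R3 -> R) (x : R3).

Definition leb2 : {sigma_finite_measure set (R1 * R1)%type -> \bar R} :=
  sigma_finite_product mu mu.
Definition sleb3 : {sigma_finite_measure set R3 -> \bar R} :=
  sigma_finite_product leb2 mu.

Lemma sleb3E : (sleb3 : {measure set R3 -> \bar R}) = @leb3 R.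
Proof. by []. Qed.

Lemma leb3_tonelli (F : R3 -> \bar R) : measurable_fun setT F ->
  (forall x, 0 <= F x)%E ->
  (\int[sleb3]_x F x = \int[mu]_a \int[mu]_b \int[mu]_c F (a, b, c))%E.
Proof.
move=> mF F0.
have E1 := fubini_tonelli1 (m1 := leb2) (m2 := mu) F mF F0.
rewrite [LHS]E1.
have mG := measurable_fun_fubini_tonelli_F (m2 := mu) F mF.
have G0 p : (0 <= fubini_F mu F p)%E by apply: integral_ge0.
exact: (fubini_tonelli1 (m1 := mu) (m2 := mu) _ (mG F0) G0).
Qed.

(* Through [rot4], the integration variable of [op3] on one side of the duality
   is the last coordinate of the point on the other side. *)
Definition rot4 (w : R3 * R1) : R4 := (w.1.1.1, (w.1.1.2, w.1.2, w.2)).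

Lemma measurable_rot4 : measurable_fun setT rot4.
Proof.
have n11 : measurable_fun setT (fun w : (R3 * R1)%type => w.1.1.1 : R1).
  exact: (measurableT_comp measurable_coord1 measurable_fst).
have n12 : measurable_fun setT (fun w : (R3 * R1)%type => w.1.1.2 : R1).
  exact: (measurableT_comp measurable_coord2 measurable_fst).
have n2 : measurable_fun setT (fun w : (R3 * R1)%type => w.1.2 : R1).
  exact: (measurableT_comp measurable_coord3 measurable_fst).
apply: (measurable_fun_pair n11); apply: measurable_fun_pair.
  exact: (measurable_fun_pair n12 n2).
exact: measurable_snd.
Qed.

(** Both sides are the same fourfold iterated integral; only the grouping of the coordinates
    differs. *)
Lemma integral_rot4 (F : R4 -> \bar R) : measurable_fun setT F ->
  (forall z, 0 <= F z)%E ->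
  (\int[mu \x sleb3]_z F z = \int[sleb3 \x mu]_w F (rot4 w))%E.
Proof.
move=> mF F0.
have mFr : measurable_fun setT (fun w => F (rot4 w)).
  exact: (measurableT_comp mF measurable_rot4).
rewrite (fubini_tonelli1 (m1 := mu) (m2 := sleb3) F mF F0).
rewrite (fubini_tonelli1 (m1 := sleb3) (m2 := mu) _ mFr (fun w => F0 _)).
rewrite leb3_tonelli.
- apply: eq_integral => a _; rewrite /fubini_F leb3_tonelli//.
  exact: measurable_fun_pair2.
- exact: (measurable_fun_fubini_tonelli_F (m2 := mu) _ mFr (fun w => F0 _)).
- by move=> x; apply: integral_ge0.
Qed.

End ProductIntegrals.

(** * Duality under reversal of the coordinates *)

Section Duality.
Context {R : realType}.
Notation mu := (@lebesgue_measure R).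
Local Notation R1 := (measurableTypeR R).
Local Notation R3 := (R1 * R1 * R1)%type.
Local Notation R4 := (R1 * R3)%type.
Local Notation fam := (bool -> bool -> R -> R).
Implicit Types (g G f : R3 -> R) (x : R3).
Local Notation leb := (@sleb3 R).
Local Notation I01 := (\1_(`[0, 1]%classic : set R) : R -> R).

Definition rev3 (x : R3) : R3 := (x.2, x.1.2, x.1.1).

Lemma measurable_rev3 : measurable_fun setT rev3.
Proof.
apply: (measurable_fun_pair _ measurable_coord1).
exact: (measurable_fun_pair measurable_coord3 measurable_coord2).
Qed.

(** The common integrand of both sides of the duality. For f vanishing outside the cube, only the
    last coordinate needs an indicator. *)
Definition dker G f : R4 -> R := fun z =>
  I01 z.2.2 * G (rev3 z.2) * ker3 f z.

Lemma measurable_dker G f : measurable_fun setT G -> measurable_fun setT f ->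
  measurable_fun setT (dker G f).
Proof.
move=> mG mf; apply: measurable_funM; last exact: measurable_ker3.
apply: measurable_funM.
  have mI : measurable_fun setT I01 by exact: measurable_indic.
  exact: (measurableT_comp mI (measurableT_comp measurable_coord3 measurable_snd)).
exact: (measurableT_comp mG (measurableT_comp measurable_rev3 measurable_snd)).
Qed.

Lemma integral_I01 (c : \bar R) : (0 <= c)%E ->
  (\int[mu]_t ((I01 t)%:E * c) = c)%E.
Proof.
move=> c0; rewrite ge0_integralZr//.
- rewrite integral_indic// setIT.
  by rewrite [X in (X * _)%E](lebesgue_measure_itv `[0, 1])/= lte_fin ltr01 oppr0 adde0 mul1e.
- by apply/measurable_EFinP; exact: measurable_indic.
Qed.

Lemma integral_rot4_signed (F : R4 -> \bar R) : measurable_fun setT F ->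
  (\int[mu \x leb]_z F z = \int[leb \x mu]_w F (rot4 w))%E.
Proof.
move=> mF; rewrite [LHS]integralE [RHS]integralE.
rewrite (integral_rot4 (measurable_funepos mF)); last by move=> z; exact: funepos_ge0.
rewrite (integral_rot4 (measurable_funeneg mF)); last by move=> z; exact: funeneg_ge0.
by congr (_ - _)%E; apply: eq_integral => w _; rewrite ?funeposE ?funenegE.
Qed.

Section Kernel.
Variables (G f : R3 -> R) (M : R).
Hypotheses (mG : measurable_fun setT G) (mf : measurable_fun setT f).
Hypothesis GM : forall x, `|G x| <= M.
Hypothesis intf : leb.-integrable setT (EFin \o f).
Hypothesis f0 : forall x, ~ cube x -> f x = 0.

(** Reversing the arguments of [chi] leaves it unchanged, so the kernel of G at the reversed point
    appears: this identifies the adjoint. *)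
Lemma dker_rot4 (w : R3 * R1) :
  dker G f (rot4 w) = f w.1 * (I01 w.2 * ker3 G (w.2, rev3 w.1)).
Proof.
case: w => [[[a b] c] d]; rewrite /dker /ker3 /rev3 /rot4/= (chi_rev a b c d).
ring.
Qed.

(** The integrand is dominated by M |f| times the indicator of the unit interval in the fourth
    coordinate. *)
Lemma dker_integrable : (mu \x leb)%E.-integrable setT (EFin \o dker G f).
Proof.
have mD := measurable_dker mG mf.
have mE : measurable_fun setT (fun z => `|(dker G f z)%:E|%E).
  by apply: measurableT_comp => //; exact/measurable_EFinP.
apply/integrableP; split; first exact/measurable_EFinP.
rewrite (integral_rot4 mE) => [|z]; last exact: abse_ge0.
have mr : measurable_fun setT (fun w => `|(dker G f (rot4 w))%:E|%E).
  exact: (measurableT_comp mE measurable_rot4).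
rewrite (fubini_tonelli1 (m1 := leb) (m2 := mu) _ mr (fun w => abse_ge0 _)).
have M0 : 0 <= M by apply: le_trans (GM (0,0,0)).
have mF := measurable_fun_fubini_tonelli_F (m2 := mu) _ mr (fun w => abse_ge0 _).
have [_ fin] := integrableP _ _ _ intf.
have iM := integrableZl measurableT M intf.
have [mMf Mfin] := integrableP _ _ _ iM.
apply: le_lt_trans Mfin; apply: ge0_le_integral => //.
- by move=> x _; apply: integral_ge0.
- by apply: measurableT_comp.
move=> x _; rewrite -[leRHS]integral_I01; last exact: abse_ge0.
apply: ge0_le_integral => //.
- exact: (measurableT_comp mr (pair1_measurable x)).
- by apply: emeasurable_funM => //; apply/measurable_EFinP; exact: measurable_indic.
move=> d _; rewrite dker_rot4/= -EFinM lee_fin mulrCA !normrM.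
rewrite [`|I01 d|]ger0_norm// ler_wpM2l//.
rewrite mulrC ler_wpM2r// ger0_norm ?chi_ge0//.
rewrite [leRHS](ger0_norm M0) -[leRHS]mul1r.
by apply: ler_pM => //; [exact: chi_ge0|exact: chi_le1].
Qed.

Lemma ker3_out (t : R) x : ~ (0 <= t <= 1) -> ker3 f (t, x) = 0.
Proof.
move=> t01; rewrite /ker3/= f0 ?mulr0// => /cube_in[/= h _ _]; exact: t01.
Qed.

Lemma op3_fine x : op3 f x = fine (\int[mu]_t (ker3 f (t, x))%:E).
Proof.
rewrite op3E /Rintegral integral_mkcond; congr fine; apply: eq_integral => t _.
rewrite patchE; case: ifPn => // /negP; rewrite inE/= in_itv/= => t01.
by rewrite ker3_out.
Qed.

Lemma op3_out x : ~ cube x -> I01 x.2 * op3 f x = 0.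
Proof.
move=> xc; rewrite indicE; case: (boolP (_ \in _)) => [|_]; last by rewrite mul0r.
rewrite inE/= => x2; rewrite (_ : op3 f x = 0) ?mulr0// op3_fine.
rewrite integral0_eq// => t _; rewrite /ker3/= f0 ?mulr0// => -[[/= _ a] b].
by apply: xc; split => //; split.
Qed.

Lemma fubini_G_dker x : mu.-integrable setT (fun t => (dker G f (t, x))%:E) ->
  (\int[mu]_t (dker G f (t, x))%:E = (I01 x.2 * G (rev3 x) * op3 f x)%:E)%E.
Proof.
move=> ix; set c := I01 x.2 * G (rev3 x).
(* Where the weight c vanishes, integrability of the section says nothing about [ker3 f]. *)
have [c0|c0] := eqVneq c 0.
  rewrite c0 mul0r integral0_eq// => t _.
  by rewrite /dker/= -/c c0 mul0r.
have kE t : (ker3 f (t, x))%:E = (c^-1%:E * (dker G f (t, x))%:E)%E.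
  by rewrite -EFinM /dker/= -/c mulKf.
have ik : mu.-integrable setT (fun t => (ker3 f (t, x))%:E).
  apply: (eq_integrable measurableT) (integrableZl measurableT c^-1 ix).
  by move=> t _; rewrite kE.
rewrite op3_fine EFinM fineK; last exact: integrable_fin_num.
rewrite -integralZl//.
Qed.

Lemma fubini_F_dker x :
  (\int[mu]_d (dker G f (rot4 (x, d)))%:E = (op3 G (rev3 x) * f x)%:E)%E.
Proof.
have b := ker3_bmeas (rev3 x) mG GM.
have i1 := bmeas_integrable b.
transitivity (\int[mu]_(d in `[0%R, 1%R]) ((f x)%:E * (ker3 G (d, rev3 x))%:E))%E.
  rewrite [RHS]integral_mkcond; apply: eq_integral => d _.
  rewrite patchE dker_rot4/= indicE; case: ifP => _; last by rewrite mul0r mulr0.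
  by rewrite mul1r EFinM.
rewrite integralZl// mulrC EFinM op3E /Rintegral fineK//.
exact: integrable_fin_num.
Qed.

End Kernel.

(** For signed f, measurability comes from the Fubini marginal of the kernel with G = 1, whose
    indicator stays as a factor. *)
Lemma measurable_op3_cut f : measurable_fun setT f ->
  leb.-integrable setT (EFin \o f) -> (forall x, ~ cube x -> f x = 0) ->
  measurable_fun setT (fun x => I01 x.2 * op3 f x).
Proof.
move=> mf intf f0.
have n1 x : `|(cst 1 : R3 -> R) x| <= 1 by rewrite /= normr1.
have m1 : measurable_fun setT (cst 1 : R3 -> R) by exact: measurable_cst.
have iD := dker_integrable m1 mf n1 intf.
have mG := measurable_fubini_G (m1 := mu) (m2 := leb) iD.
have := measurableT_comp (fine_measurable measurableT) mG.
congr measurable_fun; apply/funext => x /=.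
rewrite (op3_fine f0) /fubini_G/= indicE; case: (boolP (_ \in _)) => x2.
  rewrite mul1r; congr fine; apply: eq_integral => t _.
  by rewrite /dker/= indicE x2 !mul1r.
rewrite mul0r integral0_eq// => t _.
by rewrite /dker/= indicE (negPf x2) !mul0r.
Qed.

Section Adjoint.
Variables (G f : R3 -> R) (M : R).
Hypotheses (mG : measurable_fun setT G) (mf : measurable_fun setT f).
Hypothesis GM : forall x, `|G x| <= M.
Hypothesis intf : leb.-integrable setT (EFin \o f).
Hypothesis f0 : forall x, ~ cube x -> f x = 0.

Lemma duality_setT :
  (\int[leb]_x (I01 x.2 * G (rev3 x) * op3 f x)%:E =
   \int[leb]_x (op3 G (rev3 x) * f x)%:E)%E.
Proof.
have iD := dker_integrable mG mf GM intf.
have mD : measurable_fun setT (EFin \o dker G f).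
  by apply/measurable_EFinP; exact: measurable_dker.
have E1 := integral21_prod_meas1 (m1 := mu) (m2 := leb) iD.
have iDr : (leb \x mu)%E.-integrable setT (fun w => (dker G f (rot4 w))%:E).
  apply/integrableP; split; first exact: (measurableT_comp mD measurable_rot4).
  have [_] := integrableP _ _ _ iD; rewrite integral_rot4//.
  by apply: measurableT_comp mD.
have E2 := integral12_prod_meas1 (m1 := leb) (m2 := mu) iDr.
transitivity (\int[leb]_x fubini_G mu (EFin \o dker G f) x)%E; last first.
  rewrite E1 (integral_rot4_signed mD) -E2; apply: eq_integral => x _.
  exact: (fubini_F_dker f mG GM).
(* Sections of an integrable kernel are integrable only almost everywhere, so the marginal is not
   identified pointwise. *)
apply: ae_eq_integral => //.
- apply/measurable_EFinP.
  rewrite (_ : (fun x => _) = (fun x => G (rev3 x) * (I01 x.2 * op3 f x))); last first.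
    by apply/funext => x; rewrite -mulrA mulrCA.
  apply: measurable_funM; first exact: (measurableT_comp mG measurable_rev3).
  exact: measurable_op3_cut.
- exact: (measurable_fubini_G (m1 := mu) (m2 := leb) iD).
apply: filterS (ae_integrable2 (m1 := mu) (m2 := leb) iD) => x ix _.
by rewrite -(fubini_G_dker f0 ix).
Qed.

Lemma duality :
  (\int[leb]_(x in cube) (G (rev3 x) * op3 f x)%:E =
   \int[leb]_(x in cube) (op3 G (rev3 x) * f x)%:E)%E.
Proof.
have := duality_setT; congr (_ = _); rewrite [RHS]integral_mkcond;
  apply: eq_integral => x _; rewrite patchE.
  case: ifP => [|/negP]; rewrite inE => xc.
    by rewrite indicE mem_set ?mul1r//; case: xc.
  by rewrite mulrAC op3_out// mul0r.
by case: ifP => [|/negP]; rewrite inE => // xc; rewrite f0// mulr0.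
Qed.
End Adjoint.

End Duality.

(** * Pairings with an eigenfunction *)

Section Pairing.
Context {R : realType}.
Notation mu := (@lebesgue_measure R).
Local Notation R1 := (measurableTypeR R).
Local Notation R3 := (R1 * R1 * R1)%type.
Local Notation fam := (bool -> bool -> R -> R).
Implicit Types (g G F H : R3 -> R) (x : R3).
Local Notation leb := (@sleb3 R).

Lemma measurable_tie12 : measurable [set x : R3 | x.1.1 = x.1.2].
Proof.
have := measurable_fun_eqr (@measurable_coord1 R) (@measurable_coord2 R) =>
  /(_ measurableT [set true] I).
by rewrite setTI; congr measurable; apply/seteqP; split=> x /= /eqP.
Qed.

Lemma measurable_tie23 : measurable [set x : R3 | x.1.2 = x.2].
Proof.
have := measurable_fun_eqr (@measurable_coord2 R) (@measurable_coord3 R) =>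
  /(_ measurableT [set true] I).
by rewrite setTI; congr measurable; apply/seteqP; split=> x /= /eqP.
Qed.

Lemma integral_supp1 (h : R -> \bar R) (a : R) : (forall b, b != a -> h b = 0%E) ->
  (\int[mu]_b h b = 0)%E.
Proof.
move=> h0; rewrite -(integral_set1 h a) [RHS]integral_mkcond.
apply: eq_integral => b _; rewrite patchE; case: ifPn => // /negP ba.
by rewrite h0//; apply/eqP => ab; apply: ba; rewrite inE.
Qed.

Lemma null_tonelli (D : set R3) : measurable D ->
  (forall a, \int[mu]_b \int[mu]_c (\1_D (a, b, c))%:E = 0)%E -> leb D = 0%E.
Proof.
move=> mD D0; rewrite -(setIT D) -integral_indic// leb3_tonelli.
- by rewrite integral0_eq.
- by apply/measurable_EFinP; exact: measurable_indic.
- by move=> x; rewrite lee_fin.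
Qed.

Lemma ae_no_tie : {ae leb, forall x, x.1.1 != x.1.2 /\ x.1.2 != x.2}.
Proof.
have n12 : leb.-negligible [set x | x.1.1 = x.1.2].
  exists [set x | x.1.1 = x.1.2]; split => //; first exact: measurable_tie12.
  apply: null_tonelli measurable_tie12 _ => a.
  apply: (@integral_supp1 _ a) => b ba; apply: integral0_eq => c _.
  by rewrite indicE memNset//=; apply/eqP; rewrite eq_sym.
have n23 : leb.-negligible [set x | x.1.2 = x.2].
  exists [set x | x.1.2 = x.2]; split => //; first exact: measurable_tie23.
  apply: null_tonelli measurable_tie23 _ => a; apply: integral0_eq => b _.
  apply: (@integral_supp1 _ b) => c cb.
  by rewrite indicE memNset//=; apply/eqP; rewrite eq_sym.
have := negligibleU n12 n23; apply: negligibleS => x /=.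
by have [?|_] := eqVneq x.1.1 x.1.2; [left|have [?|_] := eqVneq x.1.2 x.2; [right|case]].
Qed.

Definition bounded_measurable G := measurable_fun setT G /\
  exists M, forall x, `|G x| <= M.

Definition cube_integrable F := [/\ measurable_fun setT F,
  leb.-integrable setT (EFin \o F) & forall x, ~ cube x -> F x = 0].

Definition pair3 F G : R := \int[leb]_(x in cube) (G (rev3 x) * F x).

Lemma measurable_cube : measurable (@cube R).
Proof. by apply: measurableX => //; apply: measurableX. Qed.

Lemma pair3_integrable F G : cube_integrable F -> bounded_measurable G ->
  leb.-integrable cube (fun x => (G (rev3 x) * F x)%:E).
Proof.
move=> [mF iF F0] [mG [M GM]].
have iF' := integrableS measurableT measurable_cube (@subsetT _ _) iF.
apply: (le_integrable measurable_cube _ _ (integrableZl measurable_cube M iF')).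
  apply/measurable_EFinP; apply: measurable_funTS; apply: measurable_funM => //.
  exact: (measurableT_comp mG measurable_rev3).
move=> x _; rewrite lee_fin !normrM ler_wpM2r//.
by apply: le_trans (GM _) _; exact: ler_norm.
Qed.

Lemma pair3_ae F G G' : cube_integrable F ->
  bounded_measurable G -> bounded_measurable G' ->
  (forall x, cube x -> x.1.1 != x.1.2 -> x.1.2 != x.2 -> G x = G' x) ->
  pair3 F G = pair3 F G'.
Proof.
move=> gF bG bG' GG; rewrite /pair3 /Rintegral; congr fine.
have i1 := pair3_integrable gF bG; have i2 := pair3_integrable gF bG'.
apply: ae_eq_integral (measurable_int _ i1) (measurable_int _ i2) _.
  exact: measurable_cube.
apply: filterS ae_no_tie => x [n12 n23] xc; congr (_ * _)%:E.
apply: GG; rewrite /= 1?eq_sym//.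
by have [h1 h2 h3] := cube_in xc; apply: in_cube.
Qed.

(** The real and the imaginary part of a complex eigenvalue equation both have this form, F and F'
    being the two parts of the eigenfunction. *)
Lemma pair3_op3 F F' G (a b : R) : cube_integrable F ->
  cube_integrable F' -> bounded_measurable G ->
  {ae leb, forall x, cube x -> op3 F x = a * F x + b * F' x} ->
  pair3 F (op3 G) = a * pair3 F G + b * pair3 F' G.
Proof.
move=> gF gF' bG aeF; have [mF iF F0] := gF; have [mG [M GM]] := bG.
have i1 := pair3_integrable gF bG; have i2 := pair3_integrable gF' bG.
rewrite /pair3 {1}/Rintegral -(duality mG mF GM iF F0).
transitivity (\int[leb]_(x in cube) (a * (G (rev3 x) * F x) + b * (G (rev3 x) * F' x))).
  rewrite /Rintegral; congr fine; apply: ae_eq_integral.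
  - exact: measurable_cube.
  - apply/measurable_EFinP; apply: measurable_funM.
      apply: measurable_funTS; exact: (measurableT_comp mG measurable_rev3).
    have := measurable_funTS (D := cube) (measurable_op3_cut mF iF F0).
    apply: eq_measurable_fun => x; rewrite inE => -[_ x2].
    by rewrite indicE mem_set ?mul1r.
  - apply/measurable_EFinP; apply: measurable_funD;
      apply: measurable_funM => //; apply/measurable_EFinP;
      [exact: measurable_int i1|exact: measurable_int i2].
  - apply: filterS aeF => x H xc; rewrite (H xc); congr (_%:E); ring.
rewrite RintegralD//; [|exact: measurable_cube|..].
- by congr (_ + _); rewrite RintegralZl//; exact: measurable_cube.
- exact: (integrableZl measurable_cube a i1).
- exact: (integrableZl measurable_cube b i2).
Qed.

Lemma pair3_le F G c : cube_integrable F -> bounded_measurable G ->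
  (forall x, cube x -> `|G x| <= c) ->
  `|pair3 F G| <= c * \int[leb]_(x in cube) `|F x|.
Proof.
move=> gF bG Gc; have i1 := pair3_integrable gF bG; have [mF iF F0] := gF.
have iF' := integrableS measurableT measurable_cube (@subsetT _ _) iF.
rewrite /pair3; apply: le_trans (le_normr_Rintegral measurable_cube i1) _.
rewrite -RintegralZl; [|exact: measurable_cube|exact: integrable_abse iF'].
apply: le_Rintegral.
- exact: measurable_cube.
- exact: integrable_abse i1.
- exact: (integrableZl measurable_cube c (integrable_abse iF')).
move=> x xc; rewrite normrM ler_wpM2r// Gc//.
by have [h1 h2 h3] := cube_in xc; apply: in_cube.
Qed.

Lemma pair3_lcomb F G G' c : cube_integrable F ->
  bounded_measurable G -> bounded_measurable G' ->
  pair3 F (fun x => G x - c * G' x) = pair3 F G - c * pair3 F G'.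
Proof.
move=> gF bG bG'; have i1 := pair3_integrable gF bG.
have i2 := pair3_integrable gF bG'.
have i3 := integrableZl measurable_cube c i2.
rewrite /pair3 -RintegralZl//; last exact: measurable_cube.
rewrite -RintegralB//; last exact: measurable_cube.
by apply: eq_Rintegral => x _; rewrite mulrBl mulrA.
Qed.

Lemma bounded_measurable_lift3 y : bfam y -> bounded_measurable (lift3 y).
Proof.
move=> by_; split.
  rewrite /lift3.
  have mp p q : measurable_fun setT (fun x : R3 => (y p q \_ `[0, 1]) x.1.1).
    apply: measurableT_comp measurable_coord1; apply/(measurable_restrictT _ _).1 => //.
    exact: (by_ p q).1.
  rewrite (_ : (fun x => _) = (fun x : R3 => if x.1.1 < x.1.2 then
    if x.1.2 < x.2 then (y true true \_ `[0, 1]) x.1.1 else (y true false \_ `[0, 1]) x.1.1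
    else if x.1.2 < x.2 then (y false true \_ `[0, 1]) x.1.1
    else (y false false \_ `[0, 1]) x.1.1)); last first.
    by apply/funext => x; case: ifP; case: ifP.
  by apply: measurable_fun_ifT; [exact: (measurable_fun_ltr measurable_coord1 measurable_coord2)|..];
    apply: measurable_fun_ifT => //; exact: (measurable_fun_ltr measurable_coord2 measurable_coord3).
have [M M0 HM] := bfam_bound by_.
exists M => x; rewrite /lift3 patchE; case: ifPn => [|_].
  by rewrite inE/= in_itv/=; exact: HM.
by rewrite normr0 ltW.
Qed.

(** Adding the constant M reduces measurability to the nonnegative case; the image of M is then
    subtracted. *)
Lemma bounded_measurable_op3 G : bounded_measurable G -> bounded_measurable (op3 G).
Proof.
move=> [mG [M GM]]; split; last by exists M => x; exact: normr_op3_le.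
have M0 : 0 <= M by apply: le_trans (GM (0, 0, 0)).
have mM : measurable_fun setT ((fun=> M) : R3 -> R) by exact: measurable_cst.
have nM x : `|((fun=> M) : R3 -> R) x| <= M by rewrite ger0_norm.
have mGM : measurable_fun setT (fun x => G x + M) by apply: measurable_funD.
have h1 : measurable_fun setT (op3 (fun x => G x + M)).
  apply: measurable_op3 => // x; have := GM x.
  by rewrite ler_norml => /andP[+ _]; rewrite -subr_ge0 opprK.
have h2 := measurable_op3 mM (fun=> M0).
have := measurable_funB h1 h2; congr measurable_fun; apply/funext => x /=.
apply/eqP; rewrite subr_eq; apply/eqP; rewrite !op3E.
rewrite -RintegralD//.
- by apply: eq_Rintegral => t _; rewrite /ker3 mulrDr.
- exact: bmeas_integrable (ker3_bmeas x mG GM).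
- exact: bmeas_integrable (ker3_bmeas x mM nM).
Qed.

Lemma eq0_pair3 F : cube_integrable F -> (forall G, measurable_fun setT G ->
  (forall x, 0 <= G x <= 1) -> pair3 F G = 0) -> {ae leb, forall x, cube x -> F x = 0}.
Proof.
move=> gF H; have [mF iF F0] := gF.
(* Indicators of F > 0 and F < 0, reversed because [pair3] reverses its test function; pairing F
   with their difference gives the integral of |F|. *)
pose G1 (x : R3) : R := ((0 < F (rev3 x))%R)%:R.
pose G2 (x : R3) : R := ((F (rev3 x) < 0)%R)%:R.
have mFr : measurable_fun setT (fun x => F (rev3 x)).
  exact: (measurableT_comp mF measurable_rev3).
have mb (B : R3 -> bool) : measurable_fun setT B ->
    measurable_fun setT (fun x => (B x)%:R : R).
  move=> mB; rewrite (_ : (fun x => _) = (fun x => if B x then 1 else 0)).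
    by apply: measurable_fun_ifT.
  by apply/funext => x; case: (B x).
have mG1 : measurable_fun setT G1 by apply: mb; exact: measurable_fun_ltr.
have mG2 : measurable_fun setT G2 by apply: mb; exact: measurable_fun_ltr.
have h1 x : 0 <= G1 x <= 1 by rewrite /G1; case: (_ < _); rewrite ?lexx ler01.
have h2 x : 0 <= G2 x <= 1 by rewrite /G2; case: (_ < _); rewrite ?lexx ler01.
have bd G : measurable_fun setT G -> (forall x, 0 <= G x <= 1) -> bounded_measurable G.
  move=> mG G01; split=> //; exists 1 => x; have /andP[g0 g1] := G01 x.
  by rewrite ger0_norm.
have := pair3_lcomb 1 gF (bd _ mG1 h1) (bd _ mG2 h2).
rewrite (H _ mG1 h1) (H _ mG2 h2) mulr0 subr0 => E.
have iF' := integrableS measurableT measurable_cube (@subsetT _ _) iF.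
have E2 : \int[leb]_(x in cube) `|F x| = 0.
  rewrite -E; apply: eq_Rintegral => -[[u v] w] _.
  rewrite /G1 /G2/= mul1r; case: (ltgtP (F (u, v, w)) 0) => [lt0|gt0|->].
  - by rewrite sub0r mulN1r ltr0_norm.
  - by rewrite subr0 mul1r gtr0_norm.
  - by rewrite normr0 mulr0.
have E3 : (\int[leb]_(x in cube) `|(EFin \o F) x| = 0)%E.
  have := integrable_fin_num measurable_cube (integrable_abse iF').
  move=> /fineK <-; congr (_%:E); exact: E2.
have := (ae_eq_integral_abs leb measurable_cube (measurable_int _ iF')).1 E3.
by apply: filterS => x Hx xc; have [] := Hx xc.
Qed.

End Pairing.

(** * Comparison of two geometric growths *)

Section GeometricZero.
Context {R : realType}.
Local Open Scope complex_scope.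
Import Normc.

Lemma normc_ge0 (z : R[i]) : 0 <= normc z.
Proof. by case: z => x y; exact: sqrtr_ge0. Qed.

Lemma le0_geometric (X Y rho : R) : 0 <= rho < 1 ->
  (forall n, X <= Y * rho ^+ n) -> X <= 0.
Proof.
move=> /andP[r0 r1] H.
have cv : (fun n => Y * rho ^+ n) @ \oo --> (0 : R).
  by apply: cvg_geometric; rewrite ger0_norm.
have := ler_cvg_to (cvg_cst X) cv; apply.
by apply: nearW => n; exact: H.
Qed.

(** Let E_n = nu^n w - lam^n k. Then E_(n+1) - lam E_n is free of k and equals nu^n w (nu - lam).
    Since lam^n <= |nu|^n, division by lam^n bounds |w| |nu - lam| by a multiple of rho^n, also when
    |nu| = lam. *)
Lemma geometric_eq0 (nu w k : R[i]) (lam rho D : R) : 0 < lam -> 0 <= rho < 1 ->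
  nu != lam%:C -> lam <= normc nu ->
  (forall n, normc (nu ^+ n * w - (lam ^+ n)%:C * k) <= D * (rho * lam) ^+ n) ->
  w = 0.
Proof.
move=> lam0 rho01 nul lnu H; have /andP[r0 r1] := rho01.
have n1 : 0 < normc (nu - lam%:C).
  rewrite lt_neqAle normc_ge0 andbT eq_sym; apply/eqP => /eq0_normc/eqP.
  by rewrite subr_eq0 (negPf nul).
have D0 : 0 <= D by have := H 0%N; rewrite expr0 mulr1; apply: le_trans; exact: normc_ge0.
have key n : normc w * normc (nu - lam%:C) <= (2 * lam * D) * rho ^+ n.
  have e : nu ^+ n * w * (nu - lam%:C) =
      (nu ^+ n.+1 * w - (lam ^+ n.+1)%:C * k)
      + - (lam%:C * (nu ^+ n * w - (lam ^+ n)%:C * k)).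
    by rewrite !exprS rmorphM/=; ring.
  have l0 : 0 < lam ^+ n by rewrite exprn_gt0.
  rewrite -(ler_pM2l l0).
  have nX : normc (nu ^+ n) = normc nu ^+ n.
    by elim: n {e l0} => [|n IH]; rewrite ?normc1// !exprS normcM IH.
  have : normc (nu ^+ n * w * (nu - lam%:C)) <=
      D * (rho * lam) ^+ n.+1 + lam * (D * (rho * lam) ^+ n).
    rewrite e; apply: le_trans (le_normcD _ _) _.
    rewrite normcN normcM; apply: lerD; first exact: H.
    apply: ler_pM; rewrite ?normc_ge0 ?H//.
    by rewrite /normc/= expr0n addr0 sqrtr_sqr gtr0_norm.
  rewrite !normcM nX -mulrA => h.
  apply: le_trans (le_trans _ h) _.
    apply: ler_wpM2r; first by rewrite mulr_ge0// normc_ge0.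
    by apply: lerXn2r; rewrite ?nnegrE ?normc_ge0 ?(ltW lam0).
  rewrite exprS exprMn.
  have p0 : 0 <= rho ^+ n by rewrite exprn_ge0.
  have : 0 <= (1 - rho) * (lam * D * (rho ^+ n * lam ^+ n)).
    by rewrite !mulr_ge0// ?(ltW lam0) ?(ltW l0)// subr_ge0 ltW.
  lra.
have := le0_geometric rho01 key; rewrite pmulr_lle0// => h.
by apply: eq0_normc; apply/eqP; rewrite eq_le h normc_ge0.
Qed.

End GeometricZero.

(** * Domination of the other eigenvalues *)

Section Domination.
Context {R : realType}.
Local Notation R1 := (measurableTypeR R).
Local Notation R3 := (R1 * R1 * R1)%type.
Local Notation fam := (bool -> bool -> R -> R).
Local Notation leb := (@sleb3 R).
Local Open Scope complex_scope.
Import Normc.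
Variables (phi : fam) (lam : R).
Hypothesis bphi : bfam phi.
Hypothesis lam_gt0 : 0 < lam.
Hypothesis phi_ge0 : lefam zfam phi.
Hypothesis eig : forall p q x, 0 <= x <= 1 -> Kop phi p q x = lam * phi p q x.
Hypothesis theta_gt0 : 0 < theta phi.

Variables (F1 F2 : R3 -> R) (a b : R).
Hypotheses (gF1 : cube_integrable F1) (gF2 : cube_integrable F2).
Hypothesis eF1 : {ae leb, forall x, cube x -> op3 F1 x = a * F1 x + (- b) * F2 x}.
Hypothesis eF2 : {ae leb, forall x, cube x -> op3 F2 x = a * F2 x + b * F1 x}.

(** The pairing of the complex function F1 + i F2 with the reversal of G. *)
Let s G : R[i] := pair3 F1 G +i* pair3 F2 G.

Lemma pairing_op3 G : bounded_measurable G -> s (op3 G) = (a +i* b) * s G.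
Proof.
move=> bG; rewrite /s (pair3_op3 gF1 gF2 bG eF1) (pair3_op3 gF2 gF1 bG eF2).
by congr (_ +i* _); rewrite ?mulNr// addrC.
Qed.

Lemma pairing_ae G G' : bounded_measurable G -> bounded_measurable G' ->
  (forall x, cube x -> x.1.1 != x.1.2 -> x.1.2 != x.2 -> G x = G' x) -> s G = s G'.
Proof. by move=> bG bG' H; congr (_ +i* _); apply: pair3_ae. Qed.

Lemma pairing_lift3 y n : bfam y -> s (lift3 (iter n Kop y)) = (a +i* b) ^+ n * s (lift3 y).
Proof.
move=> by_; elim: n => [|n IH]; first by rewrite mul1r.
have bn := bfam_iterKop n by_.
rewrite exprS -mulrA -IH -pairing_op3; last exact: bounded_measurable_lift3.
apply: pairing_ae.
- by apply: bounded_measurable_lift3; exact: (bfam_Kop bn).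
- by apply: bounded_measurable_op3; exact: bounded_measurable_lift3.
- by move=> x xc n12 n23; rewrite op3_lift3.
Qed.

Lemma eigenvalue_dominated : ~ {ae leb, forall x, cube x -> F1 x = 0 /\ F2 x = 0} ->
  a +i* b != lam%:C -> normc (a +i* b) < lam.
Proof.
move=> nz nul; rewrite ltNge; apply/negP => lnu; apply: nz.
have [rho [r0 r1 cv]] := iterKop_cvg bphi lam_gt0 phi_ge0 eig theta_gt0.
have rho01 : 0 <= rho < 1 by rewrite (ltW r0).
have nu0 : a +i* b != 0.
  by apply/eqP => e; move: lnu; rewrite e normc0 leNgt lam_gt0.
suff sG0 (G : R3 -> R) : measurable_fun setT G -> (forall x, 0 <= G x <= 1) -> s G = 0.
  have h1 := eq0_pair3 gF1 (fun G mG hG => f_equal (@complex.Re R) (sG0 G mG hG)).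
  have h2 := eq0_pair3 gF2 (fun G mG hG => f_equal (@complex.Im R) (sG0 G mG hG)).
  by apply: filterS2 h1 h2 => x e1 e2 xc; split; [exact: e1|exact: e2].
move=> mG G01.
have bG : bounded_measurable G.
  by split=> //; exists 1 => x; have /andP[g0 g1] := G01 x; rewrite ger0_norm.
have [y by_ Hy] := op3_op3 mG G01.
(* Two applications turn G into a lifted family at the price of the square of the eigenvalue, which
   is nonzero. *)
have E : s (lift3 y) = (a +i* b) ^+ 2 * s G.
  rewrite expr2 -mulrA -pairing_op3// -pairing_op3; last exact: bounded_measurable_op3.
  apply: pairing_ae.
  - exact: bounded_measurable_lift3.
  - by apply: bounded_measurable_op3; exact: bounded_measurable_op3.
  - by move=> x xc n12 n23; rewrite Hy.
have [kap [D [HD _]]] := cv y by_.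
have cmp F n : cube_integrable F ->
    `|pair3 F (lift3 (iter n Kop y)) - (kap * lam ^+ n) * pair3 F (lift3 phi)|
    <= D * (rho * lam) ^+ n * \int[leb]_(x in cube) `|F x|.
  move=> gF; have b1 := bounded_measurable_lift3 (bfam_iterKop n by_).
  have b2 := bounded_measurable_lift3 bphi.
  rewrite -pair3_lcomb//; apply: pair3_le => //.
    split; first by apply: measurable_funB; [exact: b1.1|apply: measurable_funM => //; exact: b2.1].
    have [[_ [M1 H1]] [_ [M2 H2]]] := (b1, b2).
    exists (M1 + `|kap * lam ^+ n| * M2) => x.
    by apply: le_trans (ler_normB _ _) _; rewrite normrM lerD// ler_wpM2l.
  move=> x xc; rewrite !lift3E//; apply: HD.
  by have [] := cube_in xc.
pose I1 := \int[leb]_(x in cube) `|F1 x|.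
pose I2 := \int[leb]_(x in cube) `|F2 x|.
have w0 : s (lift3 y) = 0.
  apply: (@geometric_eq0 _ (a +i* b) _ (kap%:C * s (lift3 phi)) lam rho (D * (I1 + I2)) lam_gt0 rho01 nul lnu).
  move=> n; rewrite -(pairing_lift3 n by_).
  set P1 := pair3 F1 (lift3 (iter n Kop y)) - (kap * lam ^+ n) * pair3 F1 (lift3 phi).
  set P2 := pair3 F2 (lift3 (iter n Kop y)) - (kap * lam ^+ n) * pair3 F2 (lift3 phi).
  have -> : s (lift3 (iter n Kop y)) - (lam ^+ n)%:C * (kap%:C * s (lift3 phi)) =
      P1 +i* 0 + 0 +i* P2.
    rewrite /s /P1 /P2; simpc; congr (_ +i* _); ring.
  apply: le_trans (le_normcD _ _) _.
  rewrite /normc/= expr0n/= addr0 add0r !sqrtr_sqr mulrAC mulrDr.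
  by apply: lerD; exact: cmp.
by move: E; rewrite w0 => /esym/eqP; rewrite mulf_eq0 expf_eq0 (negPf nu0)/= => /eqP.
Qed.

End Domination.

(** * Eigenvalues and asymptotics *)

Section Spectrum.
Context {R : realType}.
Notation mu := (@lebesgue_measure R).
Local Notation R1 := (measurableTypeR R).
Local Notation R3 := (R1 * R1 * R1)%type.
Local Notation fam := (bool -> bool -> R -> R).
Local Notation leb := (@sleb3 R).
Local Open Scope complex_scope.
Import Normc.
Implicit Types (f : R3 -> R[i]) (x : R3).

Definition cubeRe f : R3 -> R := (fun x => complex.Re (f x)) \_ cube.
Definition cubeIm f : R3 -> R := (fun x => complex.Im (f x)) \_ cube.

Lemma leb_box (A B C : set R) : measurable A -> measurable B -> measurable C ->
  leb (A `*` B `*` C) = (mu A * mu B * mu C)%E.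
Proof.
move=> mA mB mC.
have E1 := product_measure1E (leb2 : {sigma_finite_measure set (R1 * R1)%type -> \bar R}) mu.
rewrite [LHS]E1//; last exact: measurableX.
by congr (_ * _)%E; exact: product_measure1E.
Qed.

Lemma leb_cube : leb cube = 1%E.
Proof.
have m1 : mu `[0, 1] = 1%E by rewrite lebesgue_measure_itv/= lte_fin ltr01 oppr0 adde0.
by rewrite leb_box// m1 !mul1e.
Qed.

Lemma integral_cube_cst (c : R) : (\int[leb]_(x in cube) c%:E = c%:E)%E.
Proof.
transitivity (c%:E * leb cube)%E; first exact: (integral_cst leb measurable_cube c%:E).
by rewrite leb_cube mule1.
Qed.

Lemma opTE f x : cube x -> opT f x = op3 (cubeRe f) x +i* op3 (cubeIm f) x.
Proof.
case: x => [[x1 x2] x3] xc; have [h1 h2 h3] := cube_in xc.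
have tc (t : R) : t \in (`[0%R, 1%R]%classic : set R) -> (t, x1, x2) \in (cube : set R3).
  by rewrite !inE/= in_itv/= => t01; exact: in_cube.
rewrite /opT /cintegral /op3; congr (_ +i* _); apply: eq_Rintegral => t t01;
  rewrite /cubeRe /cubeIm patchE tc//=; case: (f _) => u v /=; ring.
Qed.

Let sq (z : R[i]) : complex.Re (`|z| ^+ 2) = complex.Re z ^+ 2 + complex.Im z ^+ 2.
Proof. by rewrite -add_Re2_Im2. Qed.

Lemma L2_integrable f : L2_cube f ->
  leb.-integrable cube (fun x => (complex.Re (`|f x| ^+ 2))%:E).
Proof.
move=> [mRe mIm fin]; apply/integrableP; split.
  apply/measurable_EFinP.
  rewrite (_ : (fun x => _) =
    (fun x => complex.Re (f x) ^+ 2 + complex.Im (f x) ^+ 2)); last first.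
    by apply/funext => x; rewrite sq.
  by apply: measurable_funD; apply: measurable_funX.
have fin' : (\int[leb]_(x in cube) (complex.Re (`|f x| ^+ 2))%:E < +oo)%E by [].
apply: le_lt_trans fin'; rewrite le_eqVlt; apply/orP; left; apply/eqP.
by apply: eq_integral => x _; rewrite gee0_abs// lee_fin sq addr_ge0// sqr_ge0.
Qed.

(** Square integrable functions on the cube, which has measure 1, are integrable since |u| <= 1 +
    u^2. It serves for h the real and the imaginary part. *)
Lemma cube_integrable_patch f (h : R[i] -> R) : L2_cube f ->
  measurable_fun cube (fun x => h (f x)) ->
  (forall z, h z ^+ 2 <= complex.Re (`|z| ^+ 2)) ->
  cube_integrable ((fun x => h (f x)) \_ cube).
Proof.
move=> L2f mh hle; have iq := L2_integrable L2f.
have i1 : leb.-integrable cube (fun=> 1%:E).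
  apply/integrableP; split; first exact: measurable_cst.
  rewrite (eq_integral (fun=> 1%:E)) => [|x _]; last by rewrite abse1.
  by rewrite integral_cube_cst ltry.
have ih : leb.-integrable cube (fun x => (h (f x))%:E).
  apply: (le_integrable measurable_cube _ _ (integrableD measurable_cube i1 iq)).
    exact/measurable_EFinP.
  move=> x _; rewrite lee_fin; have := hle (f x); set q := complex.Re _ => hq.
  have q0 : 0 <= q by apply: le_trans hq; exact: sqr_ge0.
  rewrite (ger0_norm (addr_ge0 ler01 q0)).
  have : 0 <= (`|h (f x)| - 1) ^+ 2 by exact: sqr_ge0.
  rewrite sqrrB1 real_normK ?num_real// => h2.
  have := normr_ge0 (h (f x)).
  lra.
split.
- by apply/(measurable_restrictT _ _).1 => //; exact: measurable_cube.
- have := (integrable_mkcond _ measurable_cube).1 ih.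
  by apply: eq_integrable => // x _; rewrite /= !patchE; case: ifP.
- by move=> x xc; rewrite patchE memNset.
Qed.

Lemma eigenvalue_bound (phi : fam) (lam : R) : bfam phi -> 0 < lam ->
  lefam zfam phi ->
  (forall p q (x : R), 0 <= x <= 1 -> Kop phi p q x = lam * phi p q x) ->
  0 < theta phi ->
  forall nu, is_eigenvalue nu -> nu != lam%:C -> `|nu| < `|lam%:C|.
Proof.
move=> bphi lam0 phi0 eig th0 [a b] [f [L2f nz ev]] nul.
have [mRe mIm _] := L2f.
have g1 : cube_integrable (cubeRe f) by apply: cube_integrable_patch => // z; rewrite sq lerDl sqr_ge0.
have g2 : cube_integrable (cubeIm f) by apply: cube_integrable_patch => // z; rewrite sq lerDr sqr_ge0.
have ev' : {ae leb, forall x, cube x -> opT f x = (a +i* b) * f x} by [].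
have e1 : {ae leb, forall x, cube x ->
    op3 (cubeRe f) x = a * cubeRe f x + (- b) * cubeIm f x}.
  apply: filterS ev' => x H xc; have := H xc; rewrite opTE// /cubeRe /cubeIm !patchE mem_set//.
  by case: (f x) => u v [-> _]; rewrite mulNr.
have e2 : {ae leb, forall x, cube x ->
    op3 (cubeIm f) x = a * cubeIm f x + b * cubeRe f x}.
  apply: filterS ev' => x H xc; have := H xc; rewrite opTE// /cubeRe /cubeIm !patchE mem_set//.
  by case: (f x) => u v [_ ->].
have nz' : ~ {ae leb, forall x, cube x -> cubeRe f x = 0 /\ cubeIm f x = 0}.
  move=> H; apply: nz; rewrite /ae_eq_cube -sleb3E; apply: filterS H => x H xc.
  have := H xc; rewrite /cubeRe /cubeIm !patchE mem_set//.
  by case: (f x) => u v /= [-> ->].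
have := eigenvalue_dominated bphi lam0 phi0 eig th0 g1 g2 e1 e2 nz' nul.
by rewrite !normc_def/= ltcR expr0n addr0 sqrtr_sqr gtr0_norm.
Qed.

Lemma eigenvalue_perron (phi : fam) (lam : R) : bfam phi -> 0 < lam ->
  lefam zfam phi ->
  (forall p q (x : R), 0 <= x <= 1 -> Kop phi p q x = lam * phi p q x) ->
  0 < theta phi -> is_eigenvalue lam%:C.
Proof.
move=> bphi lam0 phi0 eig th0.
have [mphi [M phiM]] := bounded_measurable_lift3 bphi.
exists (fun x => (lift3 phi x)%:C); split.
- split.
  + by apply: measurable_funTS.
  + exact: measurable_cst.
  + apply: (@le_lt_trans _ _ (\int[leb]_(x in cube) (M ^+ 2)%:E)%E).
      rewrite -sleb3E; apply: ge0_le_integral.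
      * exact: measurable_cube.
      * by move=> x _; rewrite lee_fin sq addr_ge0// sqr_ge0.
      * apply/measurable_EFinP.
        rewrite (_ : (fun x => _) = (fun x => lift3 phi x ^+ 2)); last first.
          by apply/funext => x; rewrite sq/= expr0n addr0.
        by apply: measurable_funTS; apply: measurable_funX.
      * exact: measurable_cst.
      * move=> x _; rewrite lee_fin sq/= expr0n addr0 -real_normK ?num_real//.
        by rewrite ler_sqr ?nnegrE// (le_trans _ (phiM x)).
    have -> := integral_cube_cst (M ^+ 2).
    exact: ltry.
- have [C C0 HC] := prof_le_phi bphi lam0 phi0 eig th0.
  (* On this box of positive measure the type is [true false], where [prof] is 1 and phi cannot
     vanish. *)
  pose B : set R3 := `[0, 1/3] `*` `[1/2, 1] `*` `[0, 1/3].
  move=> [N [mN N0 sub]].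
  have N0' : leb N = 0%E by [].
  have mB : measurable B by do 2 apply: measurableX => //.
  have BN : B `<=` N.
    move=> [[u v] w] [[/= hu hv] hw]; apply: sub => /=.
    move: hu hv hw; rewrite /= !in_itv/= => /andP[u0 u1] /andP[v0 v1] /andP[w0 w1] H.
    have xc : cube (u, v, w) by apply: in_cube; apply/andP; split => //; lra.
    have [] := H xc; rewrite (lift3E _ xc)/=.
    have -> : u < v by lra.
    have -> : v < w = false by apply/negbTE; rewrite -leNgt; lra.
    move=> p0; have u01 : 0 <= u <= 1 by apply/andP; split => //; lra.
    by have := HC true false u u01; rewrite p0 mulr0 /prof/= ler10.
  have : (leb B <= 0)%E by rewrite -N0'; apply: le_measure; rewrite ?inE.
  apply/negP; rewrite -ltNge leb_box//.
  have mpos (u v : R) : u < v -> (0 < mu `[u, v])%E.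
    by move=> uv; rewrite lebesgue_measure_itv/= lte_fin uv -EFinB lte_fin subr_gt0.
  by rewrite !mule_gt0//; apply: mpos; lra.
have : {ae leb, forall x, cube x -> opT (fun x => (lift3 phi x)%:C) x = lam%:C * (lift3 phi x)%:C}; last by [].
apply: filterS ae_no_tie => x [n12 n23] xc; rewrite opTE//.
rewrite -rmorphM/=; congr (_ +i* _).
  rewrite (@eq_op3 _ _ (lift3 phi)); last first.
    move=> t t01; have [h1 h2 h3] := cube_in xc.
    by rewrite /cubeRe patchE mem_set//; exact: in_cube.
  by rewrite op3_lift3// !lift3E// eig//; have [] := cube_in xc.
rewrite (@eq_op3 _ _ (fun=> 0)).
  by rewrite /op3 /Rintegral integral0_eq// => t _; rewrite mulr0.
by move=> t t01; rewrite /cubeIm patchE; case: ifP.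
Qed.

End Spectrum.

Section Main.
Context {R : realType}.
Local Open Scope complex_scope.
Local Notation fam := (bool -> bool -> R -> R).

Lemma alpha_asymptotics (phi : fam) (lam : R) : bfam phi -> 0 < lam ->
  lefam zfam phi ->
  (forall p q (x : R), 0 <= x <= 1 -> Kop phi p q x = lam * phi p q x) ->
  0 < theta phi ->
  exists c r D : R, [/\ 0 < c, 0 < r, r < lam &
    forall n, (3 <= n)%N ->
      `|(alpha n)%:R / (n`!)%:R - c * lam ^+ (n - 3)| <= D * r ^+ n].
Proof.
move=> bphi lam0 phi0 eig th0.
have [rho [r0 r1 cv]] := iterKop_cvg bphi lam0 phi0 eig th0.
have [kap [D [HD Hk]]] := cv (count_fam 0) (@bfam_count_fam R 0).
have [M M0 HM] := bfam_bound bphi.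
have i1 : 0 <= (1 : R) <= 1 by rewrite ler01 lexx.
have i0 : 0 <= (0 : R) <= 1 by rewrite lexx ler01.
(* The constant family 1 lies above phi / M, so the last clause of [iterKop_cvg] gives kap >= 1 /
   M. *)
have kap0 : 0 < kap.
  apply: lt_le_trans (Hk M^-1 _); first by rewrite invr_gt0.
  move=> p q x x01; rewrite scalE count_fam0 mulrC ler_pdivrMr// mul1r.
  exact: le_trans (ler_norm _) (HM p q x x01).
have [C C0 HC] := prof_le_phi bphi lam0 phi0 eig th0.
have ptf : 0 < phi true false 1.
  by have := HC true false 1 i1; rewrite /prof/= => h; rewrite -(pmulr_rgt0 _ C0) (lt_le_trans ltr01).
(* The factor lam ^+ 3 compensates for the exponent n - 3; the two values of phi are taken at the
   points of [alpha_iterKop]. *)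
exists (lam ^+ 3 * (kap * (phi true false 1 + phi false true 0))), (rho * lam), (D + D).
split.
- by rewrite !mulr_gt0// ?exprn_gt0// ltr_wpDr// phi0.
- by rewrite mulr_gt0.
- by rewrite gtr_pMl.
case=> [//|[//|n]] n3; rewrite alpha_iterKop.
have -> : lam ^+ 3 * (kap * (phi true false 1 + phi false true 0)) * lam ^+ (n.+2 - 3) =
    kap * lam ^+ n.+2 * phi true false 1 + kap * lam ^+ n.+2 * phi false true 0.
  rewrite -[in RHS](subnKC n3) exprD; ring.
rewrite opprD addrACA mulrDl; apply: le_trans (ler_normD _ _) _.
by apply: lerD; exact: HD.
Qed.

End Main.

Local Open Scope complex_scope.

Theorem proposition5p1 (R : realType) :
  exists lambda0 : R,
    [/\ is_largest_positive_root lambda0,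
        is_largest_eigenvalue (lambda0%:C) &
        exists c r : R,
          [/\ 0 < c, 0 < r, r < lambda0 &
              (fun n : nat => (alpha n)%:R / (n`!)%:R : R^o)
              = (fun n : nat => c * lambda0 ^+ (n - 3))
                +O_\oo (fun n : nat => r ^+ n : R^o)]].
Proof.
have [lam [phi [root bphi phi0 [eig th0]]]] := @perron_eigenfamily R.
have lam0 : 0 < lam by case: root.
exists lam; split => //.
  split; first exact: (eigenvalue_perron bphi lam0 phi0 eig th0).
  exact: (eigenvalue_bound bphi lam0 phi0 eig th0).
have [c [r [D [c0 r0 rl H]]]] := alpha_asymptotics bphi lam0 phi0 eig th0.
exists c, r; split => //.
apply/eqaddOP; near=> k; near=> n.
have rn : 0 < r ^+ n by rewrite exprn_gt0.
rewrite [in leRHS](gtr0_norm rn).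
apply: le_trans (H n _) _; first by near: n; exact: nbhs_infty_ge.
apply: ler_wpM2r; first exact: ltW.
by near: k; apply: nbhs_pinfty_ge; exact: num_real.
Unshelve. all: by end_near.
Qed.
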